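(* Let $s\in\{+1,-1\}$ and $p\in(1,\infty)$. Let $f\in PW_1$ be nonzero with $\widehat f(0)=0$, and assume $\mathcal H(f)\in L^1(\mathbb R)$. Suppose there exist $r_1,r_2>0$ such that $f(y)\ge0$ for $|y|\ge r_1$ and $s\mathcal H(f)(x)\ge0$ for $|x|\ge r_2$. Then $$r_1^{1/p'}\,r_2^{1/p}\ \ge\ 2^{-(p'+2)}\,C_p^{-\frac{p+1}{p-1}},$$ where $p'=p/(p-1)$, $C_p=\tan(\frac{\pi}{2p})$ if $1<p\le2$ and $C_p=\cot(\frac{\pi}{2p})$ if $2<p<\infty$.
   Context: $\widehat f(\xi)=\int_{\mathbb R}f(x)e^{-2\pi ix\xi}dx$. $PW_1$ is the set of real-valued continuous $f\in L^1(\mathbb R)$ with $\operatorname{supp}\widehat f\subseteq[-1,1]$. $\mathcal H$ is the Hilbert transform, $\mathcal H(f)=\mathrm{p.v.}\,f*\frac{1}{\pi x}$, so that $\widehat{\mathcal H(f)}(\xi)=-i\,\mathrm{sign}(\xi)\widehat f(\xi)$. *)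

(* Defs.v *)
From Stdlib Require Import Reals Lra.
Open Scope R_scope.

Definition integral_eq (g : R -> R) (a b v : R) : Prop :=
  exists pr : Riemann_integrable g a b, RiemannInt pr = v.

Definition improper_int (g : R -> R) (v : R) : Prop :=
  forall eps, 0 < eps -> exists M, forall a b, a <= - M -> M <= b ->
    exists w, integral_eq g a b w /\ Rabs (w - v) < eps.

Definition is_L1 (g : R -> R) : Prop :=
  (forall a b, inhabited (Riemann_integrable g a b)) /\
  exists B, forall a b, a <= b ->
    exists w, integral_eq (fun x => Rabs (g x)) a b w /\ w <= B.

(* Real and imaginary parts (up to sign) of hat f(xi) = int f(x) e^{-2 pi i x xi} dx,
   for real-valued f. *)
Definition fourier_cos_eq (f : R -> R) (xi v : R) : Prop :=
  improper_int (fun x => f x * cos (2 * PI * x * xi)) v.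
Definition fourier_sin_eq (f : R -> R) (xi v : R) : Prop :=
  improper_int (fun x => f x * sin (2 * PI * x * xi)) v.

(* PW_1 : real-valued continuous L^1 functions with supp hat f in [-1,1]
   (hat f is continuous, so this means hat f vanishes for |xi| > 1). *)
Definition PW1 (f : R -> R) : Prop :=
  continuity f /\ is_L1 f /\
  (forall xi, 1 < Rabs xi -> fourier_cos_eq f xi 0 /\ fourier_sin_eq f xi 0).

Definition hilbert_pv (f : R -> R) (x v : R) : Prop :=
  forall eps, 0 < eps -> exists delta M, 0 < delta /\
    forall e Rr, 0 < e -> e < delta -> M < Rr ->
      exists w1 w2,
        integral_eq (fun t => f (x - t) / t) (- Rr) (- e) w1 /\
        integral_eq (fun t => f (x - t) / t) e Rr w2 /\
        Rabs ((w1 + w2) / PI - v) < eps.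

Definition conj_exp (p : R) : R := p / (p - 1).

Definition Cp (p : R) : R :=
  if Rle_dec p 2 then tan (PI / (2 * p)) else 1 / tan (PI / (2 * p)).

(* Main.v *)
(** Since [Cp p >= 1], the right-hand side is at most [2^-(p'+2)], so no sharp Hilbert transform
    inequality is needed: it suffices that [r1 >= 1/8] and [r2 >= 1/16]. Both bounds follow from
    one principle. If [g] is integrable with integral 0, has constant sign outside [[-r, r]] and
    satisfies [|g| <= K ||g||_1], then [||g||_1] is twice the mass of a one-signed part living on
    [[-r, r]], hence at most [4 r K ||g||_1]. For [f], Fourier inversion gives [K = 2].
    For [h], truncated Hilbert transforms of [f] converge uniformly, so the identity [f = V * f]
    with a kernel [V], [|V| <= 4], passes to [h] and gives [K = 4]. The same uniform convergence
    gives [P_a * h = Q_a * f] for the Poisson kernel [P_a] and its conjugate [Q_a]; letting [a]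
    tend to infinity shows that [h] has integral 0, and if [h] vanished then [P_a * f] would be
    constant by the Cauchy-Riemann equations, forcing [f = 0] as [a] tends to 0. *)

Require Import Defs.
From Stdlib Require Import Reals Lra Psatz.
From Coquelicot Require Import Coquelicot.
Open Scope R_scope.

(** * Absolutely convergent integrals over the line *)

(** The obstacle is that [h] is given only as a pointwise principal value: no Fourier transform, sup
    bound or continuity comes with it, so inversion cannot be applied to it as to [f]. What does
    transfer is convolution with an integrable kernel: truncated principal values are integrals over
    a compact range, so they commute with convolution by Fubini, and they converge uniformly because
    a band-limited [f] is Lipschitz. The kernel of the sharp cutoff at frequency 1 is not
    integrable; hence a trapezoidal cutoff, whose kernel decays like u^-2, at the price of the
    constant 4 instead of 2. The theorem absorbs this loss: from 1/8 = 2^-3 and 1/16 = 2^-4 one gets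
    r1^(1/p') r2^(1/p) >= 2^-(3 + 1/p), while p' + 2 = 3 + 1/(p - 1) exceeds 3 + 1/p. Complex
    numbers are avoided by working with the integral of f(y) cos(2 pi (x - y) xi) dy, the real part
    of e^(2 pi i x xi) times the Fourier transform of [f] at [xi]; letting [x] vary recovers the
    whole transform. *)

Lemma continuity_comp_fun (f g : R -> R) :
  continuity f -> continuity g -> continuity (fun x => f (g x)).
Proof. intros Hf Hg x. apply (continuity_pt_comp g f); auto. Qed.

Lemma continuity_mult_fun (f g : R -> R) :
  continuity f -> continuity g -> continuity (fun x => f x * g x).
Proof. intros Hf Hg. apply continuity_mult; auto. Qed.

Lemma continuity_plus_fun (f g : R -> R) :
  continuity f -> continuity g -> continuity (fun x => f x + g x).
Proof. intros Hf Hg. apply continuity_plus; auto. Qed.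

Lemma continuity_minus_fun (f g : R -> R) :
  continuity f -> continuity g -> continuity (fun x => f x - g x).
Proof. intros Hf Hg. apply continuity_minus; auto. Qed.

Lemma continuity_abs_fun (f : R -> R) :
  continuity f -> continuity (fun x => Rabs (f x)).
Proof. intros Hf. apply (continuity_comp_fun Rabs); auto using Rcontinuity_abs. Qed.

Lemma continuity_scal_fun (c : R) (f : R -> R) :
  continuity f -> continuity (fun x => c * f x).
Proof. intros Hf. apply continuity_mult_fun; auto. apply continuity_const. now intros ? ?. Qed.

Lemma continuity_reflect (f : R -> R) (c : R) :
  continuity f -> continuity (fun x => f (c - x)).
Proof. intros Hf. apply continuity_comp_fun; auto. reg. Qed.

Lemma continuity_translate (f : R -> R) (c : R) :
  continuity f -> continuity (fun x => f (c + x)).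
Proof. intros Hf. apply continuity_comp_fun; auto. reg. Qed.

Lemma continuity_ex_RInt (f : R -> R) (a b : R) : continuity f -> ex_RInt f a b.
Proof.
intros Hf. apply (@ex_RInt_continuous R_CompleteNormedModule). intros z _.
apply continuity_pt_filterlim. apply Hf.
Qed.

Lemma RInt_Chasles_R (f : R -> R) (a b c : R) : continuity f ->
  RInt f a b + RInt f b c = RInt f a c.
Proof. intros Hf. apply (RInt_Chasles f a b c); now apply continuity_ex_RInt. Qed.

Lemma RInt_plus_R (f g : R -> R) (a b : R) : continuity f -> continuity g ->
  RInt (fun x => f x + g x) a b = RInt f a b + RInt g a b.
Proof. intros Hf Hg. apply (RInt_plus f g); now apply continuity_ex_RInt. Qed.

Lemma RInt_scal_R (c : R) (f : R -> R) (a b : R) : continuity f ->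
  RInt (fun x => c * f x) a b = c * RInt f a b.
Proof. intros Hf. apply (RInt_scal f); now apply continuity_ex_RInt. Qed.

Lemma RInt_minus_R (f g : R -> R) (a b : R) : continuity f -> continuity g ->
  RInt (fun x => f x - g x) a b = RInt f a b - RInt g a b.
Proof. intros Hf Hg. apply (RInt_minus f g); now apply continuity_ex_RInt. Qed.

Lemma RInt_le_R (f g : R -> R) (a b : R) : continuity f -> continuity g ->
  a <= b -> (forall x, a <= x <= b -> f x <= g x) -> RInt f a b <= RInt g a b.
Proof.
intros Hf Hg Hab H.
apply RInt_le; auto using continuity_ex_RInt. intros x Hx; apply H; lra.
Qed.

Lemma abs_RInt_le_R (f g : R -> R) (a b : R) : continuity f -> continuity g ->
  a <= b -> (forall x, a <= x <= b -> Rabs (f x) <= g x) ->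
  Rabs (RInt f a b) <= RInt g a b.
Proof.
intros Hf Hg Hab H.
apply Rle_trans with (1 := abs_RInt_le f a b Hab (continuity_ex_RInt f a b Hf)).
apply RInt_le_R; auto using continuity_abs_fun.
Qed.

Lemma RInt_ext_R (f g : R -> R) (a b : R) : a <= b ->
  (forall x, a < x < b -> f x = g x) -> RInt f a b = RInt g a b.
Proof.
intros Hab H. apply RInt_ext. intros x. rewrite Rmin_left, Rmax_right by auto. apply H.
Qed.

Lemma RInt_const_R (c a b : R) : RInt (fun _ => c) a b = (b - a) * c.
Proof. exact (@RInt_const R_CompleteNormedModule a b c). Qed.

Lemma RInt_reflect (f : R -> R) (c a b : R) : continuity f ->
  RInt (fun x => f (c - x)) a b = RInt f (c - b) (c - a).
Proof.
intros Hf.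
assert (Hr := continuity_reflect f c Hf).
assert (H := RInt_comp_lin f (-1) c a b (continuity_ex_RInt _ _ _ Hf)).
rewrite (RInt_ext _ (fun x => -1 * f (c - x))) in H.
2:{ intros x _. unfold scal; simpl; unfold mult; simpl. do 2 f_equal; ring. }
rewrite RInt_scal_R in H by auto.
replace (-1 * a + c) with (c - a) in H by ring.
replace (-1 * b + c) with (c - b) in H by ring.
rewrite <- (opp_RInt_swap f) in H by now apply continuity_ex_RInt.
unfold opp in H; simpl in H. lra.
Qed.

Lemma RInt_nonneg (f : R -> R) (a b : R) : continuity f -> a <= b ->
  (forall x, 0 <= f x) -> 0 <= RInt f a b.
Proof. intros Hf Hab H. apply RInt_ge_0; auto using continuity_ex_RInt. Qed.

Lemma RInt_interval_mono (f : R -> R) (a b c d : R) : continuity f ->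
  (forall x, 0 <= f x) -> c <= a -> a <= b -> b <= d -> RInt f a b <= RInt f c d.
Proof.
intros Hf H0 H1 H2 H3.
rewrite <- (RInt_Chasles_R f c a d), <- (RInt_Chasles_R f a b d) by auto.
assert (0 <= RInt f c a) by now apply RInt_nonneg.
assert (0 <= RInt f b d) by now apply RInt_nonneg.
lra.
Qed.

(** The two ends go to infinity independently, which makes the value stable under reflections and
    translations. *)
Definition is_int (g : R -> R) (v : R) : Prop :=
  forall eps, 0 < eps -> exists M, 0 <= M /\
    forall a b, a <= - M -> M <= b -> Rabs (RInt g a b - v) <= eps.

(** Continuity is built in so that every Riemann integral over a compact interval exists without
    further checks. *)
Definition abs_integrable (g : R -> R) : Prop :=
  continuity g /\ exists B, forall a b, a <= b -> RInt (fun x => Rabs (g x)) a b <= B.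

(** A total function, so that integrals can be rewritten as terms. It is the improper integral as
    soon as [is_int] holds for some value. *)
Definition Int (g : R -> R) : R := real (Lim_seq (fun n => RInt g (- INR n) (INR n))).

Lemma is_int_Int (g : R -> R) (v : R) : is_int g v -> Int g = v.
Proof.
intros H. unfold Int. rewrite (is_lim_seq_unique _ v); auto.
apply is_lim_seq_spec. intros eps.
destruct (H (eps / 2)) as [M [HM HH]]. { destruct eps; simpl; lra. }
destruct (nfloor_ex M HM) as [N [_ HN]].
exists (S N). intros n Hn.
assert (M <= INR n). { apply le_INR in Hn. rewrite S_INR in Hn. lra. }
apply Rle_lt_trans with (eps / 2); [|destruct eps; simpl; lra].
apply HH; lra.
Qed.

Lemma is_int_plus (f g : R -> R) (u v : R) : continuity f -> continuity g ->
  is_int f u -> is_int g v -> is_int (fun x => f x + g x) (u + v).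
Proof.
intros Cf Cg Hf Hg eps He.
destruct (Hf (eps / 2)) as [M [HM H1]]; [lra|].
destruct (Hg (eps / 2)) as [N [HN H2]]; [lra|].
exists (Rmax M N). split. { apply Rle_trans with M; auto; apply Rmax_l. }
intros a b Ha Hb.
assert (h1 := Rmax_l M N). assert (h2 := Rmax_r M N).
rewrite RInt_plus_R by auto.
replace (_ - _) with ((RInt f a b - u) + (RInt g a b - v)) by ring.
eapply Rle_trans; [apply Rabs_triang|].
specialize (H1 a b). specialize (H2 a b). lra.
Qed.

Lemma is_int_scal (c : R) (f : R -> R) (u : R) : continuity f ->
  is_int f u -> is_int (fun x => c * f x) (c * u).
Proof.
intros Cf Hf eps He.
assert (h := Rabs_pos c).
destruct (Hf (eps / (Rabs c + 1))) as [M [HM H1]]. { apply Rdiv_lt_0_compat; lra. }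
exists M. split; auto. intros a b Ha Hb.
rewrite RInt_scal_R by auto.
replace (_ - _) with (c * (RInt f a b - u)) by ring.
rewrite Rabs_mult. specialize (H1 a b Ha Hb).
apply Rle_trans with ((Rabs c + 1) * (eps / (Rabs c + 1))).
- apply Rmult_le_compat; auto using Rabs_pos; lra.
- right. field. lra.
Qed.

Lemma is_int_ext (f g : R -> R) (u : R) : (forall x, f x = g x) -> is_int f u -> is_int g u.
Proof.
intros E H eps He. destruct (H eps He) as [M [HM H1]]. exists M; split; auto.
intros a b Ha Hb. rewrite <- (RInt_ext f) by auto. auto.
Qed.

(** The value is the supremum of the integrals over symmetric intervals. By positivity, an
    asymmetric interval is squeezed between two symmetric ones. *)
Lemma is_int_nonneg_ex (g : R -> R) : continuity g -> (forall x, 0 <= g x) ->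
  (exists B, forall a b, a <= b -> RInt g a b <= B) -> exists v, is_int g v.
Proof.
intros Cg Pg [B HB].
destruct (completeness (fun y => exists n, 0 <= n /\ y = RInt g (- n) n)) as [v [Hv1 Hv2]].
- exists B. intros y [n [Hn ->]]. apply HB. lra.
- exists (RInt g (- 0) 0). exists 0. split; lra.
- exists v. intros eps He.
  assert (exists n, 0 <= n /\ v - eps < RInt g (- n) n) as [M [HM H1]].
  { destruct (Classical_Prop.classic (exists n, 0 <= n /\ v - eps < RInt g (- n) n)) as [|Hn]; auto.
    exfalso. assert (v <= v - eps); [|lra]. apply Hv2. intros y [n [Hn1 ->]].
    apply Rnot_lt_le. intros Hl. apply Hn. now exists n. }
  exists M. split; auto. intros a b Ha Hb.
  assert (RInt g (- M) M <= RInt g a b) by (apply RInt_interval_mono; auto; lra).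
  assert (RInt g a b <= v).
  { assert (h1 := Rmax_l (- a) b). assert (h2 := Rmax_r (- a) b).
    apply Rle_trans with (RInt g (- Rmax (- a) b) (Rmax (- a) b)).
    - apply RInt_interval_mono; auto; lra.
    - apply Hv1. exists (Rmax (-a) b). split; auto; lra. }
  apply Rabs_le; lra.
Qed.

(** Write g = (|g| + g) - |g|, a difference of two nonnegative functions with bounded integrals. *)
Lemma abs_integrable_is_int (g : R -> R) : abs_integrable g -> is_int g (Int g).
Proof.
intros [Cg [B HB]].
assert (Ca := continuity_abs_fun g Cg).
destruct (is_int_nonneg_ex (fun x => Rabs (g x))) as [u Hu]; auto using Rabs_pos.
{ now exists B. }
destruct (is_int_nonneg_ex (fun x => Rabs (g x) + g x)) as [v Hv].
- now apply continuity_plus_fun.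
- intros x. unfold Rabs. destruct (Rcase_abs (g x)); lra.
- exists (2 * B). intros a b Hab.
  apply Rle_trans with (RInt (fun x => 2 * Rabs (g x)) a b).
  + apply RInt_le_R; auto using continuity_plus_fun, continuity_scal_fun.
    intros x _. assert (h := Rle_abs (g x)). lra.
  + rewrite RInt_scal_R by auto. specialize (HB a b Hab). lra.
- assert (H : is_int g (v + -1 * u)).
  { apply is_int_ext with (fun x => (Rabs (g x) + g x) + -1 * Rabs (g x)). { intros; ring. }
    apply is_int_plus; auto using continuity_plus_fun, continuity_scal_fun, is_int_scal. }
  now rewrite (is_int_Int _ _ H).
Qed.

Lemma abs_integrable_abs (g : R -> R) : abs_integrable g -> abs_integrable (fun x => Rabs (g x)).
Proof.
intros [Cg [B HB]]. split; auto using continuity_abs_fun.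
exists B. intros a b Hab. rewrite (RInt_ext _ (fun x => Rabs (g x))); auto.
intros; apply Rabs_Rabsolu.
Qed.

Lemma abs_integrable_dom (g k : R -> R) (K : R) : continuity g -> abs_integrable k ->
  (forall x, Rabs (g x) <= K * Rabs (k x)) -> abs_integrable g.
Proof.
intros Cg [Ck [B HB]] H. split; auto.
exists (Rabs K * B). intros a b Hab.
apply Rle_trans with (RInt (fun x => Rabs K * Rabs (k x)) a b).
- apply RInt_le_R; auto using continuity_scal_fun, continuity_abs_fun.
  intros x _. eapply Rle_trans; [apply H|].
  apply Rmult_le_compat_r; auto using Rabs_pos, Rle_abs.
- rewrite RInt_scal_R by auto using continuity_abs_fun.
  apply Rmult_le_compat_l; auto using Rabs_pos.
Qed.

Lemma abs_integrable_scal (c : R) (f : R -> R) : abs_integrable f ->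
  abs_integrable (fun x => c * f x).
Proof.
intros Hf. apply abs_integrable_dom with f (Rabs c); auto.
- apply continuity_scal_fun, Hf.
- intros x. rewrite Rabs_mult. lra.
Qed.

Lemma abs_integrable_plus (f g : R -> R) : abs_integrable f -> abs_integrable g ->
  abs_integrable (fun x => f x + g x).
Proof.
intros [Cf [B HB]] [Cg [C HC]]. split; auto using continuity_plus_fun.
exists (B + C). intros a b Hab.
apply Rle_trans with (RInt (fun x => Rabs (f x) + Rabs (g x)) a b).
- apply RInt_le_R; auto using continuity_plus_fun, continuity_abs_fun.
  intros; apply Rabs_triang.
- rewrite RInt_plus_R by auto using continuity_abs_fun.
  apply Rplus_le_compat; auto.
Qed.

Lemma abs_integrable_ext (f g : R -> R) : (forall x, f x = g x) ->
  abs_integrable f -> abs_integrable g.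
Proof.
intros E [Cf [B HB]]. split.
- intros x. apply (continuity_pt_ext f); auto.
- exists B. intros a b Hab. rewrite <- (RInt_ext (fun x => Rabs (f x))); auto.
  intros x _. now rewrite E.
Qed.

Lemma abs_integrable_minus (f g : R -> R) : abs_integrable f -> abs_integrable g ->
  abs_integrable (fun x => f x - g x).
Proof.
intros Hf Hg. apply abs_integrable_ext with (fun x => f x + -1 * g x).
- intros; ring.
- apply abs_integrable_plus; auto. now apply abs_integrable_scal.
Qed.

Lemma abs_integrable_mult_bounded (f m : R -> R) (K : R) : abs_integrable f -> continuity m ->
  (forall x, Rabs (m x) <= K) -> abs_integrable (fun x => f x * m x).
Proof.
intros Hf Cm H. apply abs_integrable_dom with f K; auto.
- apply continuity_mult_fun; auto. apply Hf.
- intros x. rewrite Rabs_mult, Rmult_comm.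
  apply Rmult_le_compat_r; auto using Rabs_pos.
Qed.

Lemma Int_ext (f g : R -> R) : (forall x, f x = g x) -> Int f = Int g.
Proof.
intros E. unfold Int. f_equal. apply Lim_seq_ext. intros n. now apply RInt_ext.
Qed.

Lemma Int_plus (f g : R -> R) : abs_integrable f -> abs_integrable g ->
  Int (fun x => f x + g x) = Int f + Int g.
Proof.
intros Hf Hg. apply is_int_Int, is_int_plus; try apply Hf; try apply Hg;
now apply abs_integrable_is_int.
Qed.

Lemma Int_scal (c : R) (f : R -> R) : abs_integrable f -> Int (fun x => c * f x) = c * Int f.
Proof.
intros Hf. apply is_int_Int, is_int_scal; try apply Hf. now apply abs_integrable_is_int.
Qed.

Lemma Int_minus (f g : R -> R) : abs_integrable f -> abs_integrable g ->
  Int (fun x => f x - g x) = Int f - Int g.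
Proof.
intros Hf Hg. rewrite (Int_ext _ (fun x => f x + -1 * g x)) by (intros; ring).
rewrite Int_plus, Int_scal; auto using abs_integrable_scal. ring.
Qed.

Lemma is_int_limit_le (f : R -> R) (u c a0 b0 : R) : is_int f u ->
  (forall a b, a <= a0 -> b0 <= b -> RInt f a b <= c) -> u <= c.
Proof.
intros Hf H. apply le_epsilon. intros eps He.
destruct (Hf eps He) as [M [HM H1]].
specialize (H1 (Rmin a0 (- M)) (Rmax b0 M) (Rmin_r _ _) (Rmax_r _ _)).
specialize (H (Rmin a0 (- M)) (Rmax b0 M) (Rmin_l _ _) (Rmax_l _ _)).
apply Rabs_le_between in H1. lra.
Qed.

Lemma RInt_le_Int (f : R -> R) (a b : R) : abs_integrable f -> (forall x, 0 <= f x) ->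
  a <= b -> RInt f a b <= Int f.
Proof.
intros Hf H0 Hab.
assert (H1 := is_int_scal (-1) f _ (proj1 Hf) (abs_integrable_is_int f Hf)).
assert (H2 : -1 * Int f <= - RInt f a b); [|lra].
apply (is_int_limit_le _ _ _ a b H1).
intros c d Hc Hd. rewrite RInt_scal_R by apply Hf.
assert (RInt f a b <= RInt f c d) by (apply RInt_interval_mono; auto; apply Hf).
lra.
Qed.

(** On the two outer pieces the integral of [f] is at most that of [g]; then the outer ends go to
    infinity. This quantitative form stands in for dominated convergence in all that follows. *)
Lemma Int_tail_dom (f g : R -> R) (a b : R) : continuity f -> abs_integrable g ->
  (forall x, Rabs (f x) <= g x) -> a <= b ->
  Rabs (Int f - RInt f a b) <= Int g - RInt g a b.
Proof.
intros Cf Hg H Hab.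
assert (Cg := proj1 Hg).
assert (g0 : forall x, 0 <= g x). { intros x. eapply Rle_trans; [apply Rabs_pos|apply H]. }
assert (Hf : abs_integrable f).
{ apply abs_integrable_dom with g 1; auto. intros x.
  rewrite (Rabs_pos_eq (g x)), Rmult_1_l; auto. }
assert (T : forall c d, c <= a -> b <= d ->
  Rabs (RInt f c d - RInt f a b) <= Int g - RInt g a b).
{ intros c d Hc Hd.
  assert (h1 := abs_RInt_le_R f g c a Cf Cg Hc (fun x _ => H x)).
  assert (h2 := abs_RInt_le_R f g b d Cf Cg Hd (fun x _ => H x)).
  assert (h3 := RInt_le_Int g c d Hg g0 ltac:(lra)).
  rewrite <- (RInt_Chasles_R g c a d), <- (RInt_Chasles_R g a b d) in h3 by auto.
  rewrite <- (RInt_Chasles_R f c a d), <- (RInt_Chasles_R f a b d) by auto.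
  replace (_ - RInt f a b) with (RInt f c a + RInt f b d) by ring.
  eapply Rle_trans; [apply Rabs_triang|]. lra. }
assert (I1 := abs_integrable_is_int f Hf).
assert (I2 := is_int_scal (-1) f _ Cf I1).
apply Rabs_le. split.
- cut (-1 * Int f <= Int g - RInt g a b - RInt f a b). { lra. }
  apply (is_int_limit_le _ _ _ a b I2). intros c d Hc Hd.
  rewrite RInt_scal_R by auto.
  specialize (T c d Hc Hd). apply Rabs_le_between in T. lra.
- cut (Int f <= Int g - RInt g a b + RInt f a b). { lra. }
  apply (is_int_limit_le _ _ _ a b I1). intros c d Hc Hd.
  specialize (T c d Hc Hd). apply Rabs_le_between in T. lra.
Qed.

Lemma Int_abs_le (f g : R -> R) : continuity f -> abs_integrable g ->
  (forall x, Rabs (f x) <= g x) -> Rabs (Int f) <= Int g.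
Proof.
intros Cf Hg H.
(* On the degenerate interval [0, 0] the tail is the whole integral. *)
assert (h := Int_tail_dom f g 0 0 Cf Hg H (Rle_refl 0)).
rewrite !RInt_point in h. unfold zero in h; simpl in h.
now rewrite !Rminus_0_r in h.
Qed.

Lemma Int_nonneg (f : R -> R) : abs_integrable f -> (forall x, 0 <= f x) -> 0 <= Int f.
Proof.
intros Hf H. apply Rle_trans with (RInt f 0 0); [|apply RInt_le_Int; auto; lra].
rewrite RInt_point. apply Rle_refl.
Qed.

Lemma Int_tail_small (g : R -> R) (eps : R) : abs_integrable g -> 0 < eps ->
  exists M, 0 <= M /\ forall a b, a <= - M -> M <= b -> Int g - RInt g a b <= eps.
Proof.
intros Hg He. destruct (abs_integrable_is_int g Hg eps He) as [M [HM H]].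
exists M; split; auto. intros a b Ha Hb. specialize (H a b Ha Hb).
apply Rabs_le_between in H. lra.
Qed.

Lemma abs_integrable_reflect (g : R -> R) (c : R) : abs_integrable g ->
  abs_integrable (fun x => g (c - x)).
Proof.
intros [Cg [B HB]]. split; auto using continuity_reflect.
exists B. intros a b Hab.
rewrite (RInt_reflect (fun x => Rabs (g x))) by auto using continuity_abs_fun.
apply HB. lra.
Qed.

Lemma Int_reflect (g : R -> R) (c : R) : abs_integrable g ->
  Int (fun x => g (c - x)) = Int g.
Proof.
intros Hg. apply is_int_Int. intros eps He.
destruct (abs_integrable_is_int g Hg eps He) as [M [HM H]].
exists (M + Rabs c). assert (h := Rabs_pos c). split; [lra|].
intros a b Ha Hb. rewrite RInt_reflect by apply Hg.
assert (h1 := Rle_abs c). assert (h2 := Rle_abs (- c)). rewrite Rabs_Ropp in h2.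
apply H; lra.
Qed.

(** A translation is a composition of two reflections: c + x = c - (0 - x). *)
Lemma abs_integrable_translate (g : R -> R) (c : R) : abs_integrable g ->
  abs_integrable (fun x => g (c + x)).
Proof.
intros Hg. apply (abs_integrable_ext (fun x => (fun y => g (c - y)) (0 - x))).
- intros x; f_equal; ring.
- apply (abs_integrable_reflect (fun y => g (c - y))). now apply abs_integrable_reflect.
Qed.

Lemma Int_translate (g : R -> R) (c : R) : abs_integrable g ->
  Int (fun x => g (c + x)) = Int g.
Proof.
intros Hg. rewrite (Int_ext _ (fun x => (fun y => g (c - y)) (0 - x))).
- rewrite (Int_reflect (fun y => g (c - y))), Int_reflect; auto using abs_integrable_reflect.
- intros x; f_equal; ring.
Qed.

(** * Integrals depending on a parameter *)

Lemma continuity_pt_of_le (f : R -> R) (x : R) :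
  (forall eps, 0 < eps -> exists d, 0 < d /\
    forall y, Rabs (y - x) < d -> Rabs (f y - f x) <= eps) -> continuity_pt f x.
Proof.
intros H eps He. destruct (H (eps / 2)) as [d [Hd H1]]; [lra|].
exists d; split; auto. intros y [_ Hy].
apply Rle_lt_trans with (eps / 2); [|lra]. now apply H1.
Qed.

Lemma continuity_pt_lt (f : R -> R) (x eps : R) : continuity_pt f x -> 0 < eps ->
  exists d, 0 < d /\ forall y, Rabs (y - x) < d -> Rabs (f y - f x) < eps.
Proof.
intros H He. destruct (H eps He) as [d [Hd H1]].
exists d; split; auto. intros y Hy.
destruct (Req_dec x y) as [->|Hxy].
- rewrite Rminus_diag, Rabs_R0. auto.
- apply (H1 y). split; auto. split; auto. exact I.
Qed.

Lemma continuity_uniform_limit (f : R -> R) :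
  (forall eps, 0 < eps -> exists g, continuity g /\ forall x, Rabs (g x - f x) <= eps) ->
  continuity f.
Proof.
intros H x. apply continuity_pt_of_le. intros eps He.
destruct (H (eps / 3)) as [g [Cg Hg]]; [lra|].
destruct (continuity_pt_lt g x (eps / 3) (Cg x)) as [d [Hd H1]]; [lra|].
exists d; split; auto. intros y Hy. specialize (H1 y Hy).
assert (h1 := Hg x). assert (h2 := Hg y).
apply Rabs_le_between in h1. apply Rabs_le_between in h2.
apply Rabs_lt_between in H1. apply Rabs_le. lra.
Qed.

Definition continuous2 (F : R -> R -> R) : Prop := forall x y, continuity_2d_pt F x y.

Lemma continuous2_comp (f : R -> R) (G : R -> R -> R) : continuity f -> continuous2 G ->
  continuous2 (fun x y => f (G x y)).
Proof. intros Hf HG x y. apply continuity_1d_2d_pt_comp; auto. Qed.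

Lemma continuous2_mult (F G : R -> R -> R) : continuous2 F -> continuous2 G ->
  continuous2 (fun x y => F x y * G x y).
Proof. intros HF HG x y. apply continuity_2d_pt_mult; auto. Qed.

Lemma continuous2_plus (F G : R -> R -> R) : continuous2 F -> continuous2 G ->
  continuous2 (fun x y => F x y + G x y).
Proof. intros HF HG x y. apply continuity_2d_pt_plus; auto. Qed.

Lemma continuous2_minus (F G : R -> R -> R) : continuous2 F -> continuous2 G ->
  continuous2 (fun x y => F x y - G x y).
Proof. intros HF HG x y. apply continuity_2d_pt_minus; auto. Qed.

Lemma continuous2_const (c : R) : continuous2 (fun _ _ => c).
Proof. intros x y. apply continuity_2d_pt_const. Qed.

Lemma continuous2_fst : continuous2 (fun x _ => x).
Proof. intros x y. apply continuity_2d_pt_id1. Qed.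

Lemma continuous2_snd : continuous2 (fun _ y => y).
Proof. intros x y. apply continuity_2d_pt_id2. Qed.

Lemma continuous2_swap (F : R -> R -> R) : continuous2 F -> continuous2 (fun x y => F y x).
Proof.
intros H x y eps. destruct (H y x eps) as [d Hd]. exists d. intros u v Hu Hv. now apply Hd.
Qed.

Lemma continuous2_section (F : R -> R -> R) (x : R) : continuous2 F -> continuity (F x).
Proof.
intros H y. apply continuity_pt_of_le. intros eps He.
destruct (H x y (mkposreal eps He)) as [d Hd]. exists d. split; [apply cond_pos|].
intros z Hz. left. apply Hd; auto. rewrite Rminus_diag, Rabs_R0. apply cond_pos.
Qed.

Lemma continuity_RInt_param (F : R -> R -> R) (a b : R) : continuous2 F -> a <= b ->
  continuity (fun t => RInt (fun y => F y t) a b).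
Proof.
intros HF Hab t. apply continuity_pt_of_le. intros eps He.
(* The [+ 1] keeps the denominator positive when [a = b]. *)
assert (He' : 0 < eps / (b - a + 1)). { apply Rdiv_lt_0_compat; lra. }
destruct (uniform_continuity_2d_1d F a b t (fun x _ => HF x t) (mkposreal _ He')) as [d Hd].
exists d. split; [apply cond_pos|]. intros s Hs.
assert (CF : forall u, continuity (fun y => F y u)).
{ intros u. apply (continuous2_section (fun u y => F y u)). now apply continuous2_swap. }
rewrite <- RInt_minus_R by auto.
apply Rle_trans with ((b - a) * (eps / (b - a + 1))).
- apply abs_RInt_le_const; auto. { apply continuity_ex_RInt, continuity_minus_fun; auto. }
  intros y Hy. left. apply Hd; auto.
  + destruct d; simpl; lra.
  + apply Rabs_lt_between in Hs. lra.
  + rewrite Rminus_diag, Rabs_R0. apply cond_pos.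
- apply Rle_trans with ((b - a + 1) * (eps / (b - a + 1))).
  + apply Rmult_le_compat_r; lra.
  + right; field; lra.
Qed.

Lemma is_derive_RInt_R (f : R -> R) (a x : R) : continuity f ->
  is_derive (fun s => RInt f a s) x (f x).
Proof.
intros Hf. apply (is_derive_RInt f (fun s => RInt f a s) a).
- exists (mkposreal 1 Rlt_0_1). intros y _. apply (@RInt_correct R_CompleteNormedModule).
  now apply continuity_ex_RInt.
- apply continuity_pt_filterlim, Hf.
Qed.

(** As functions of the upper limit [s] of the [t]-integral, both sides have the same derivative and
    vanish at [s = c]; [Phi] is their difference. *)
Lemma RInt_Fubini (F : R -> R -> R) (a b c d : R) : continuous2 F -> a <= b -> c <= d ->
  RInt (fun y => RInt (fun t => F y t) c d) a b =
  RInt (fun t => RInt (fun y => F y t) a b) c d.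
Proof.
intros HF Hab Hcd.
set (Phi := fun s => RInt (fun y => RInt (fun t => F y t) c s) a b -
   RInt (fun t => RInt (fun y => F y t) a b) c s).
assert (DR : forall y s, Derive (fun z => RInt (fun t => F y t) c z) s = F y s).
{ intros y s. apply is_derive_unique, is_derive_RInt_R. now apply continuous2_section. }
assert (D : forall s, c <= s <= d -> is_derive Phi s 0).
{ intros s Hs. rewrite <- (Rminus_diag (RInt (fun y => F y s) a b)).
  apply (is_derive_minus (K := R_AbsRing) (V := R_NormedModule)
     (fun s => RInt (fun y => RInt (fun t => F y t) c s) a b)).
  - rewrite (RInt_ext (fun y => F y s)
      (fun t => Derive (fun u => RInt (fun t0 => F t t0) c u) s)) by (intros; now rewrite DR).
    apply (is_derive_RInt_param (fun s y => RInt (fun t => F y t) c s)).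
    + exists (mkposreal 1 Rlt_0_1). intros z _ t _. exists (F t z).
      apply is_derive_RInt_R. now apply continuous2_section.
    + intros t _. apply continuity_2d_pt_ext with (fun u v => F v u).
      * intros u v. now rewrite DR.
      * now apply continuous2_swap.
    (* Differentiating at the end point [c] involves upper limits [z] below [c], for which the inner
       integral is reversed. *)
    + exists (mkposreal 1 Rlt_0_1). intros z Hz. destruct (Rle_dec c z) as [H|H].
      * apply continuity_ex_RInt.
        apply (continuity_RInt_param (fun t y => F y t)); auto using continuous2_swap.
      * apply ex_RInt_ext with (fun t => - RInt (fun t0 => F t t0) z c).
        { intros t _. apply (opp_RInt_swap (fun t0 => F t t0)).
          apply continuity_ex_RInt. now apply continuous2_section. }
        apply continuity_ex_RInt, continuity_opp.
        apply (continuity_RInt_param (fun t y => F y t)); auto using continuous2_swap. lra.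
  - apply (is_derive_RInt_R (fun t => RInt (fun y => F y t) a b)).
    now apply continuity_RInt_param. }
assert (E : Phi c = Phi d).
{ destruct Hcd as [Hcd|Hcd]; [|now rewrite Hcd]. now apply (eq_is_derive Phi). }
assert (Z : forall f : R -> R, RInt f c c = 0) by (intros f; apply (@RInt_point R_CompleteNormedModule)).
unfold Phi in E. rewrite Z in E.
rewrite (RInt_ext _ (fun _ => 0) a b) in E by (intros; apply Z).
rewrite RInt_const_R in E. lra.
Qed.

(** The majorant [G] does not depend on [t], so the tails are small uniformly and the integral is a
    uniform limit of integrals over compact intervals. *)
Lemma continuity_Int_param (F : R -> R -> R) (G : R -> R) :
  continuous2 F -> abs_integrable G -> (forall y t, Rabs (F y t) <= G y) ->
  continuity (fun t => Int (fun y => F y t)).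
Proof.
intros HF HG Hdom.
apply continuity_uniform_limit. intros eps He.
destruct (Int_tail_small G eps HG He) as [M [HM H]].
exists (fun t => RInt (fun y => F y t) (- M) M). split.
- apply continuity_RInt_param; auto. lra.
- intros t. rewrite <- Rabs_Ropp, Ropp_minus_distr.
  eapply Rle_trans; [|apply (H (- M) M); lra].
  apply Int_tail_dom; auto; [|lra].
  apply (continuous2_section (fun u y => F y u)). now apply continuous2_swap.
Qed.

(** Compact Fubini on [c, d] x [a, b], then [c] and [d] go to infinity with an error controlled by
    the tail of [G], uniformly in [t]. One unbounded variable is enough here, since the other is
    always a truncation variable or a frequency. *)
Lemma Int_Fubini (F : R -> R -> R) (G : R -> R) (a b : R) :
  continuous2 F -> abs_integrable G -> (forall y t, Rabs (F y t) <= G y) -> a <= b ->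
  Int (fun y => RInt (fun t => F y t) a b) = RInt (fun t => Int (fun y => F y t)) a b.
Proof.
intros HF HG Hdom Hab.
assert (CI := continuity_Int_param F G HF HG Hdom).
apply is_int_Int. intros eps He.
assert (He' : 0 < eps / (b - a + 1)). { apply Rdiv_lt_0_compat; lra. }
destruct (Int_tail_small G _ HG He') as [M [HM H]].
exists M; split; auto. intros c d Hc Hd.
rewrite RInt_Fubini by (auto; lra).
assert (C1 : continuity (fun t => RInt (fun y => F y t) c d)).
{ apply continuity_RInt_param; auto; lra. }
rewrite <- RInt_minus_R; auto.
apply Rle_trans with ((b - a) * (eps / (b - a + 1))).
- apply abs_RInt_le_const; auto.
  { apply continuity_ex_RInt, continuity_minus_fun; auto. }
  intros t _. rewrite <- Rabs_Ropp, Ropp_minus_distr.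
  eapply Rle_trans; [|apply (H c d); lra].
  apply Int_tail_dom; auto; [|lra].
  apply (continuous2_section (fun u y => F y u)). now apply continuous2_swap.
- apply Rle_trans with ((b - a + 1) * (eps / (b - a + 1))).
  + apply Rmult_le_compat_r; lra.
  + right; field; lra.
Qed.

(** * Truncated Hilbert transforms and convolution *)

Definition norm1 (g : R -> R) : R := Int (fun x => Rabs (g x)).

Definition Lipschitz (L : R) (g : R -> R) : Prop :=
  0 <= L /\ forall x y, Rabs (g x - g y) <= L * Rabs (x - y).

Definition conv (k g : R -> R) (x : R) : R := Int (fun u => k u * g (x - u)).

Lemma norm1_nonneg (g : R -> R) : abs_integrable g -> 0 <= norm1 g.
Proof. intros Hg. apply Int_nonneg; auto using abs_integrable_abs, Rabs_pos. Qed.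

Lemma abs_integrable_conv (k g : R -> R) (x K : R) : abs_integrable k -> continuity g ->
  (forall y, Rabs (g y) <= K) -> abs_integrable (fun u => k u * g (x - u)).
Proof.
intros Hk Cg HK. apply abs_integrable_mult_bounded with K; auto using continuity_reflect.
Qed.

Lemma conv_abs_le (k g : R -> R) (x K : R) : abs_integrable k -> continuity g ->
  (forall y, Rabs (g y) <= K) -> Rabs (conv k g x) <= K * norm1 k.
Proof.
intros Hk Cg HK. unfold conv, norm1. rewrite <- Int_scal by now apply abs_integrable_abs.
apply Int_abs_le.
- now apply (abs_integrable_conv k g x K).
- now apply abs_integrable_scal, abs_integrable_abs.
- intros u. rewrite Rabs_mult, Rmult_comm. apply Rmult_le_compat_r; auto using Rabs_pos.
Qed.

Lemma conv_comm (k g : R -> R) (x K : R) : abs_integrable k -> continuity g ->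
  (forall y, Rabs (g y) <= K) -> conv k g x = conv g k x.
Proof.
intros Hk Cg HK. unfold conv.
rewrite <- (Int_reflect (fun u => k u * g (x - u)) x).
- apply Int_ext. intros u. rewrite Rmult_comm. do 2 f_equal; ring.
- now apply (abs_integrable_conv k g x K).
Qed.

(* The weight coincides with 1/t on [1/N, N]; truncating it below makes it continuous on the line. *)
Definition weight (N t : R) : R := / Rmax t (/ N).

(** The two halves of the principal value are folded onto t > 0, so that the difference of values of
    [g] cancels the singularity. A single parameter governs the cutoffs at 0 and at infinity. *)
Definition truncated_hilbert (N : R) (g : R -> R) (x : R) : R :=
  / PI * RInt (fun t => weight N t * (g (x - t) - g (x + t))) (/ N) N.

Lemma inv_le_self (N : R) : 1 <= N -> 0 < / N <= 1 /\ / N <= N.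
Proof.
intros HN. assert (0 < / N) by (apply Rinv_0_lt_compat; lra).
assert (/ N <= 1) by (rewrite <- Rinv_1; apply Rinv_le_contravar; lra). lra.
Qed.

Lemma weight_continuity (N : R) : 1 <= N -> continuity (weight N).
Proof.
intros HN t. destruct (inv_le_self N HN) as [h _].
apply continuity_pt_inv.
- apply continuity_pt_ext with (fun t => (t + / N + Rabs (t - / N)) / 2).
  { intros s. unfold Rmax, Rabs.
    destruct (Rle_dec s (/ N)); destruct (Rcase_abs (s - / N)); lra. }
  apply (continuity_mult_fun (fun t => t + / N + Rabs (t - / N)) (fun _ => / 2)).
  + apply (continuity_plus_fun (fun t => t + / N)); [reg|].
    apply (continuity_abs_fun (fun t => t - / N)). reg.
  + reg.
- assert (h1 := Rmax_r t (/ N)). lra.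
Qed.

Lemma weight_bound (N t : R) : 1 <= N -> 0 <= weight N t <= N.
Proof.
intros HN. destruct (inv_le_self N HN) as [h _]. unfold weight.
assert (h1 := Rmax_r t (/ N)). split.
- left. apply Rinv_0_lt_compat. lra.
- rewrite <- (Rinv_inv N) at 2. apply Rinv_le_contravar; lra.
Qed.

Lemma weight_eq (N t : R) : / N <= t -> weight N t = / t.
Proof. intros H. unfold weight. now rewrite Rmax_left. Qed.

Lemma hilbert_integrand_continuity (N : R) (g : R -> R) (x : R) : 1 <= N -> continuity g ->
  continuity (fun t => weight N t * (g (x - t) - g (x + t))).
Proof.
intros HN Cg. apply (continuity_mult_fun (weight N)); auto using weight_continuity.
apply continuity_minus_fun; auto using continuity_reflect, continuity_translate.
Qed.

(** Between 1/M and 1/N the integrand is at most 2L by the Lipschitz condition, over a length at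
    most 1/N. Between N and M the weight is at most 1/N and the two shifts of [g] have total mass at
    most 2 ||g||_1. Neither bound depends on [x]. *)
Lemma truncated_hilbert_cauchy (g : R -> R) (L N M x : R) :
  abs_integrable g -> Lipschitz L g -> 1 <= N -> N <= M ->
  Rabs (truncated_hilbert M g x - truncated_hilbert N g x) <= (2 * L + 2 * norm1 g) / N.
Proof.
intros Hg [HL Lg] HN HNM.
assert (Cg := proj1 Hg).
destruct (inv_le_self N HN) as [n1 n2]. destruct (inv_le_self M ltac:(lra)) as [m1 m2].
assert (hi : / M <= / N) by (apply Rinv_le_contravar; lra).
assert (CI : continuity (fun t => weight M t * (g (x - t) - g (x + t))))
  by (apply hilbert_integrand_continuity; auto; lra).
assert (I1 : Rabs (RInt (fun t => weight M t * (g (x - t) - g (x + t))) (/ M) (/ N)) <=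
  2 * L / N).
{ eapply Rle_trans; [apply (abs_RInt_le_const _ _ _ (2 * L))|].
  - auto.
  - now apply continuity_ex_RInt.
  - intros t Ht. rewrite weight_eq by lra. rewrite Rabs_mult, Rabs_inv, (Rabs_pos_eq t) by lra.
    specialize (Lg (x - t) (x + t)).
    replace (x - t - (x + t)) with (- (2 * t)) in Lg by ring.
    rewrite Rabs_Ropp, (Rabs_pos_eq (2 * t)) in Lg by lra.
    apply Rmult_le_reg_l with t; [lra|].
    rewrite <- Rmult_assoc, Rinv_r by lra. lra.
  - unfold Rdiv. rewrite Rmult_comm. apply Rmult_le_compat_l; lra. }
assert (I2 : Rabs (RInt (fun t => weight M t * (g (x - t) - g (x + t))) N M) <=
  2 * norm1 g / N).
{ set (k := fun t => / N * (Rabs (g (x - t)) + Rabs (g (x + t)))).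
  assert (A1 := abs_integrable_reflect _ x (abs_integrable_abs _ Hg)).
  assert (A2 := abs_integrable_translate _ x (abs_integrable_abs _ Hg)).
  assert (Ak : abs_integrable k) by now apply abs_integrable_scal, abs_integrable_plus.
  apply Rle_trans with (RInt k N M).
  - apply abs_RInt_le_R; auto; [apply Ak|].
    intros t Ht. rewrite weight_eq by lra. unfold k.
    rewrite Rabs_mult, Rabs_inv, (Rabs_pos_eq t) by lra.
    apply Rmult_le_compat; auto using Rabs_pos.
    + left; apply Rinv_0_lt_compat; lra.
    + apply Rinv_le_contravar; lra.
    + unfold Rminus at 1. eapply Rle_trans; [apply Rabs_triang|]. rewrite Rabs_Ropp. lra.
  - eapply Rle_trans; [apply RInt_le_Int; auto|].
    + intros t. apply Rmult_le_pos; [lra|]. apply Rplus_le_le_0_compat; apply Rabs_pos.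
    + unfold k. rewrite Int_scal, Int_plus; auto using abs_integrable_plus.
      rewrite (Int_reflect (fun y => Rabs (g y)) x), (Int_translate (fun y => Rabs (g y)) x);
        auto using abs_integrable_abs.
      unfold norm1. right; field. lra. }
assert (E : truncated_hilbert M g x - truncated_hilbert N g x =
  / PI * (RInt (fun t => weight M t * (g (x - t) - g (x + t))) (/ M) (/ N) +
   RInt (fun t => weight M t * (g (x - t) - g (x + t))) N M)).
{ unfold truncated_hilbert.
  rewrite <- (RInt_Chasles_R _ (/ M) (/ N) M), <- (RInt_Chasles_R _ (/ N) N M) by auto.
  rewrite (RInt_ext_R (fun t => weight N t * (g (x - t) - g (x + t)))
    (fun t => weight M t * (g (x - t) - g (x + t))) (/ N) N).
  - ring.
  - lra.
  - intros t Ht. now rewrite !weight_eq by lra. }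
rewrite E, Rabs_mult.
assert (hp := PI2_1).
assert (hp1 : 0 < / PI <= 1).
{ split; [apply Rinv_0_lt_compat; lra|]. rewrite <- Rinv_1. apply Rinv_le_contravar; lra. }
rewrite (Rabs_pos_eq (/ PI)) by lra.
assert (hs := Rabs_triang (RInt (fun t => weight M t * (g (x - t) - g (x + t))) (/ M) (/ N))
   (RInt (fun t => weight M t * (g (x - t) - g (x + t))) N M)).
assert (h0 := Rabs_pos (RInt (fun t => weight M t * (g (x - t) - g (x + t))) (/ M) (/ N) +
   RInt (fun t => weight M t * (g (x - t) - g (x + t))) N M)).
replace ((2 * L + 2 * norm1 g) / N) with (2 * L / N + 2 * norm1 g / N) by (field; lra).
nra.
Qed.

(** Only a pointwise limit along one parameter; [truncated_hilbert_rate] upgrades it to uniform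
    convergence for Lipschitz [g]. *)
Definition is_hilbert (g G : R -> R) : Prop :=
  forall x eps, 0 < eps -> exists N0, forall N, N0 <= N ->
    Rabs (truncated_hilbert N g x - G x) <= eps.

(** Let the larger parameter go to infinity in the Cauchy estimate, whose bound does not involve
    it. *)
Lemma truncated_hilbert_rate (g G : R -> R) (L N x : R) :
  abs_integrable g -> Lipschitz L g -> is_hilbert g G -> 1 <= N ->
  Rabs (truncated_hilbert N g x - G x) <= (2 * L + 2 * norm1 g) / N.
Proof.
intros Hg HL HG HN. apply le_epsilon. intros eps He.
destruct (HG x eps He) as [N0 H0].
assert (h1 := H0 (Rmax N0 N) (Rmax_l _ _)).
assert (h2 := truncated_hilbert_cauchy g L N (Rmax N0 N) x Hg HL HN (Rmax_r _ _)).
apply Rabs_le_between in h1. apply Rabs_le_between in h2. apply Rabs_le. lra.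
Qed.

Lemma hilbert_integrand_continuous2 (N : R) (g : R -> R) : 1 <= N -> continuity g ->
  continuous2 (fun x t => weight N t * (g (x - t) - g (x + t))).
Proof.
intros HN Cg. apply continuous2_mult.
- apply (continuous2_comp (weight N) (fun _ t => t)); auto using weight_continuity, continuous2_snd.
- apply continuous2_minus.
  + apply (continuous2_comp g (fun x t => x - t)); auto.
    apply continuous2_minus; auto using continuous2_fst, continuous2_snd.
  + apply (continuous2_comp g (fun x t => x + t)); auto.
    apply continuous2_plus; auto using continuous2_fst, continuous2_snd.
Qed.

Lemma truncated_hilbert_continuity (N : R) (g : R -> R) : 1 <= N -> continuity g ->
  continuity (truncated_hilbert N g).
Proof.
intros HN Cg. unfold truncated_hilbert. apply continuity_scal_fun.
apply (continuity_RInt_param (fun t x => weight N t * (g (x - t) - g (x + t)))).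
- apply (continuous2_swap (fun x t => weight N t * (g (x - t) - g (x + t)))).
  now apply hilbert_integrand_continuous2.
- now apply inv_le_self.
Qed.

Lemma exists_large_quotient (K eps : R) : 0 <= K -> 0 < eps -> exists N, 1 <= N /\ K / N <= eps.
Proof.
intros HK He. exists (1 + K / eps).
assert (h : 0 <= K / eps) by (apply Rdiv_le_0_compat; lra).
split; [lra|]. apply Rle_div_l; [lra|].
replace (eps * (1 + K / eps)) with (eps + K) by (field; lra). lra.
Qed.

(** A uniform limit of continuous functions. This supplies the continuity that [abs_integrable]
    demands of the Hilbert transform. *)
Lemma hilbert_continuity (g G : R -> R) (L : R) :
  abs_integrable g -> Lipschitz L g -> is_hilbert g G -> continuity G.
Proof.
intros Hg HL HG. apply continuity_uniform_limit. intros eps He.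
assert (h0 := norm1_nonneg g Hg).
destruct (exists_large_quotient (2 * L + 2 * norm1 g) eps) as [N [HN H]];
  [destruct HL; lra|auto|].
exists (truncated_hilbert N g). split.
- apply truncated_hilbert_continuity; auto. apply Hg.
- intros x. eapply Rle_trans; [|apply H]. now apply truncated_hilbert_rate.
Qed.

(** Fubini applies because [t] stays in [1/N, N], where the weight is at most N, so the double
    integrand is dominated by 2KN |k(u)|. *)
Lemma conv_truncated_hilbert (k g : R -> R) (K N x : R) : abs_integrable k -> continuity g ->
  (forall y, Rabs (g y) <= K) -> 1 <= N ->
  conv k (truncated_hilbert N g) x = truncated_hilbert N (conv k g) x.
Proof.
intros Hk Cg HK HN.
assert (hp := PI2_1). assert (HN' := inv_le_self N HN).
assert (K0 : 0 <= K) by (eapply Rle_trans; [apply Rabs_pos|apply (HK 0)]).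
set (F := fun u t => k u * (weight N t * (g (x - u - t) - g (x - u + t)))).
assert (CF : continuous2 F).
{ apply (continuous2_mult (fun u _ => k u)).
  - apply (continuous2_comp k (fun u _ => u)); [apply Hk|apply continuous2_fst].
  - intros u t.
    (* Reflecting [g] exchanges the shifts by [t] and [-t], hence the factor -1 below. *)
    assert (C := hilbert_integrand_continuous2 N (fun z => g (x - z)) HN
      (continuity_reflect _ _ Cg)).
    apply continuity_2d_pt_ext with (fun u v => -1 *
      (weight N v * ((fun z => g (x - z)) (u - v) - (fun z => g (x - z)) (u + v)))).
    + intros y s. replace (x - y - s) with (x - (y + s)) by ring.
      replace (x - y + s) with (x - (y - s)) by ring. ring.
    + apply continuous2_mult; auto using continuous2_const. }
assert (DF : forall u t, Rabs (F u t) <= 2 * K * N * Rabs (k u)).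
{ intros u t. unfold F. rewrite Rabs_mult, Rmult_comm.
  apply Rmult_le_compat_r; auto using Rabs_pos. rewrite Rabs_mult.
  destruct (weight_bound N t HN) as [w0 w1]. rewrite (Rabs_pos_eq (weight N t)) by lra.
  assert (h1 := HK (x - u - t)). assert (h2 := HK (x - u + t)).
  assert (h : Rabs (g (x - u - t) - g (x - u + t)) <= 2 * K).
  { unfold Rminus at 1. eapply Rle_trans; [apply Rabs_triang|]. rewrite Rabs_Ropp. lra. }
  rewrite (Rmult_comm (2 * K)). apply Rmult_le_compat; auto using Rabs_pos. }
assert (Dk : abs_integrable (fun u => 2 * K * N * Rabs (k u))).
{ now apply abs_integrable_scal, abs_integrable_abs. }
assert (CR : continuity (fun u => RInt (fun t => F u t) (/ N) N)).
{ apply (continuity_RInt_param (fun t u => F u t)); auto using continuous2_swap. lra. }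
unfold conv at 1, truncated_hilbert.
rewrite (Int_ext _ (fun u => / PI * RInt (fun t => F u t) (/ N) N)).
2:{ intros u. unfold F. rewrite RInt_scal_R; [ring|].
    now apply hilbert_integrand_continuity. }
rewrite Int_scal.
2:{ apply abs_integrable_dom with k ((N - / N) * (2 * K * N)); auto.
    intros u. rewrite Rmult_assoc. apply abs_RInt_le_const; [lra| |auto].
    apply continuity_ex_RInt. now apply continuous2_section. }
f_equal. rewrite (Int_Fubini F _ _ _ CF Dk DF) by lra.
apply RInt_ext. intros t _. unfold conv.
assert (A1 := abs_integrable_conv k g (x - t) K Hk Cg HK).
assert (A2 := abs_integrable_conv k g (x + t) K Hk Cg HK).
rewrite <- Int_minus, <- Int_scal; auto using abs_integrable_minus.
apply Int_ext. intros u. unfold F.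
replace (x - u - t) with (x - t - u) by ring.
replace (x - u + t) with (x + t - u) by ring. ring.
Qed.

(** Uniform convergence of the truncations to [G], tested against the integrable [k], gives
    convergence of the convolutions with error C ||k||_1 / N. The value is therefore whatever limit
    can be computed at the truncated level. *)
Lemma conv_hilbert_limit (k g G : R -> R) (L x v : R) : abs_integrable k ->
  abs_integrable g -> Lipschitz L g -> is_hilbert g G -> (exists K, forall y, Rabs (g y) <= K) ->
  (forall eps, 0 < eps -> exists N0, forall N, N0 <= N -> 1 <= N ->
    Rabs (conv k (truncated_hilbert N g) x - v) <= eps) ->
  conv k G x = v.
Proof.
intros Hk Hg HL HG [K HK] H.
assert (Cg := proj1 Hg).
assert (CG := hilbert_continuity g G L Hg HL HG).
set (C := 2 * L + 2 * norm1 g).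
assert (C0 : 0 <= C).
{ assert (h := norm1_nonneg g Hg). destruct HL. unfold C. lra. }
assert (k0 := norm1_nonneg k Hk).
apply cond_eq. intros eps He.
destruct (H (eps / 4)) as [N0 HN0]; [lra|].
destruct (exists_large_quotient (C * norm1 k) (eps / 4)) as [N1 [HN1 Q]];
  [now apply Rmult_le_pos|lra|].
set (N := Rmax N0 N1).
assert (hN0 := Rmax_l N0 N1). assert (hN1 := Rmax_r N0 N1). fold N in hN0, hN1.
specialize (HN0 N hN0 ltac:(lra)).
assert (D : forall y, Rabs (truncated_hilbert N g y - G y) <= C / N).
{ intros y. apply truncated_hilbert_rate; auto. lra. }
assert (CT := truncated_hilbert_continuity N g ltac:(lra) Cg).
assert (D1 := conv_abs_le k (fun y => truncated_hilbert N g y - G y) x (C / N) Hk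
   (continuity_minus_fun _ _ CT CG) D).
assert (N0p : 0 < / N) by (apply Rinv_0_lt_compat; lra).
(* This bound grows with [N]; it serves only to make the convolutions with the truncation and with
   [G] absolutely convergent. *)
assert (BT : exists KT, forall y, Rabs (truncated_hilbert N g y) <= KT).
{ exists (/ PI * ((N - / N) * (N * (2 * K)))). intros y. unfold truncated_hilbert.
  assert (hp := PI2_1).
  rewrite Rabs_mult, (Rabs_pos_eq (/ PI)) by (left; apply Rinv_0_lt_compat; lra).
  apply Rmult_le_compat_l; [left; apply Rinv_0_lt_compat; lra|].
  apply abs_RInt_le_const.
  - apply inv_le_self; lra.
  - apply continuity_ex_RInt, hilbert_integrand_continuity; auto; lra.
  - intros t _. rewrite Rabs_mult. destruct (weight_bound N t) as [w0 w1]; [lra|].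
    rewrite (Rabs_pos_eq (weight N t)) by lra.
    apply Rmult_le_compat; auto using Rabs_pos.
    assert (h1 := HK (y - t)). assert (h2 := HK (y + t)).
    unfold Rminus at 1. eapply Rle_trans; [apply Rabs_triang|]. rewrite Rabs_Ropp. lra. }
destruct BT as [KT HT].
assert (BG : forall y, Rabs (G y) <= KT + C / N).
{ intros y. assert (h1 := HT y). assert (h2 := D y).
  replace (G y) with (truncated_hilbert N g y - (truncated_hilbert N g y - G y)) by ring.
  unfold Rminus at 1. eapply Rle_trans; [apply Rabs_triang|]. rewrite Rabs_Ropp. lra. }
assert (E : conv k (fun y => truncated_hilbert N g y - G y) x =
   conv k (truncated_hilbert N g) x - conv k G x).
{ unfold conv. rewrite <- Int_minus.
  - apply Int_ext. intros; ring.
  - now apply abs_integrable_conv with KT.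
  - now apply abs_integrable_conv with (KT + C / N). }
rewrite E in D1.
assert (Q2 : C / N * norm1 k <= eps / 4).
{ eapply Rle_trans; [|apply Q].
  replace (C / N * norm1 k) with (C * norm1 k * / N) by (unfold Rdiv; ring).
  unfold Rdiv. apply Rmult_le_compat_l; [now apply Rmult_le_pos|].
  apply Rinv_le_contravar; lra. }
apply Rabs_le_between in D1. apply Rabs_le_between in HN0.
apply Rabs_lt_between. lra.
Qed.

(** At each truncation level, k * H_N g = H_N (k * g) = H_N g, and the last term tends to [G x]. *)
Lemma conv_hilbert_fixed (k g G : R -> R) (L x : R) : abs_integrable k ->
  abs_integrable g -> Lipschitz L g -> is_hilbert g G -> (exists K, forall y, Rabs (g y) <= K) ->
  (forall y, conv k g y = g y) -> conv k G x = G x.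
Proof.
intros Hk Hg HL HG HK Hfix.
apply (conv_hilbert_limit k g G L); auto. intros eps He.
destruct (HG x eps He) as [N0 HN0]. exists N0. intros N h1 h2.
destruct HK as [K HK].
rewrite (conv_truncated_hilbert k g K) by (auto; apply Hg).
specialize (HN0 N h1). unfold truncated_hilbert in *.
rewrite (RInt_ext _ (fun t => weight N t * (g (x - t) - g (x + t)))); auto.
intros t _. now rewrite !Hfix.
Qed.

(** At each truncation level, k * H_N g = H_N (k * g) = g * H_N k. The uniform rate is then used
    twice, once for [g] and once for [k]. *)
Lemma conv_hilbert_transfer (k kH g G : R -> R) (L Lk x : R) : abs_integrable k ->
  Lipschitz Lk k -> (exists K, forall y, Rabs (k y) <= K) -> is_hilbert k kH ->
  (exists K, forall y, Rabs (kH y) <= K) ->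
  abs_integrable g -> Lipschitz L g -> is_hilbert g G -> (exists K, forall y, Rabs (g y) <= K) ->
  conv k G x = conv g kH x.
Proof.
intros Hk HLk [Kk HKk] HkH [KH HKH] Hg HL HG [K HK].
assert (Cg := proj1 Hg). assert (Ck := proj1 Hk).
apply (conv_hilbert_limit k g G L); auto. { now exists K. }
intros eps He.
set (C := 2 * Lk + 2 * norm1 k).
assert (C0 : 0 <= C).
{ assert (h := norm1_nonneg k Hk). destruct HLk. unfold C. lra. }
assert (g0 := norm1_nonneg g Hg).
destruct (exists_large_quotient (C * norm1 g) eps) as [N0 [HN0 Q]];
  [now apply Rmult_le_pos|lra|].
exists N0. intros N h1 h2.
assert (CkH := hilbert_continuity k kH Lk Hk HLk HkH).
rewrite (conv_truncated_hilbert k g K) by auto.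
assert (E : truncated_hilbert N (conv k g) x = conv g (truncated_hilbert N k) x).
{ rewrite (conv_truncated_hilbert g k Kk) by auto.
  unfold truncated_hilbert. f_equal. apply RInt_ext. intros t _.
  now rewrite !(conv_comm k g _ K Hk Cg HK). }
rewrite E.
assert (D : forall y, Rabs (truncated_hilbert N k y - kH y) <= C / N).
{ intros y. now apply truncated_hilbert_rate. }
assert (CT := truncated_hilbert_continuity N k h2 Ck).
assert (D1 := conv_abs_le g (fun y => truncated_hilbert N k y - kH y) x (C / N) Hg
   (continuity_minus_fun _ _ CT CkH) D).
assert (E2 : conv g (fun y => truncated_hilbert N k y - kH y) x =
   conv g (truncated_hilbert N k) x - conv g kH x).
{ unfold conv. rewrite <- Int_minus.
  - apply Int_ext. intros; ring.
  - apply abs_integrable_conv with (KH + C / N); auto.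
    intros y. specialize (D y). specialize (HKH y).
    apply Rabs_le_between in D. apply Rabs_le_between in HKH. apply Rabs_le. lra.
  - now apply abs_integrable_conv with KH. }
rewrite <- E2. eapply Rle_trans; [apply D1|]. eapply Rle_trans; [|apply Q].
replace (C / N * norm1 g) with (C * norm1 g * / N) by (unfold Rdiv; ring).
unfold Rdiv. apply Rmult_le_compat_l; [now apply Rmult_le_pos|].
apply Rinv_le_contravar; lra.
Qed.

(** * The Poisson kernel and its conjugate *)

(** Without the customary factor 1/pi, so the total mass is pi. Its conjugate decays only like 1/u
    and is not integrable, which is why it always occurs as the bounded factor of a convolution. *)
Definition poisson (a u : R) : R := a / (u ^ 2 + a ^ 2).
Definition conj_poisson (a u : R) : R := u / (u ^ 2 + a ^ 2).

Lemma sum_sqr_pos (a u : R) : 0 < a -> 0 < u ^ 2 + a ^ 2.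
Proof. intros Ha. nra. Qed.

Lemma poisson_continuity (a : R) : 0 < a -> continuity (poisson a).
Proof.
intros Ha. unfold poisson. intros u. assert (h := sum_sqr_pos a u Ha).
assert (continuity_pt (fun u => a / (u ^ 2 + a ^ 2)) u); auto. reg. lra.
Qed.

Lemma conj_poisson_continuity (a : R) : 0 < a -> continuity (conj_poisson a).
Proof.
intros Ha. unfold conj_poisson. intros u. assert (h := sum_sqr_pos a u Ha).
assert (continuity_pt (fun u => u / (u ^ 2 + a ^ 2)) u); auto. reg. lra.
Qed.

Lemma poisson_pos (a u : R) : 0 < a -> 0 < poisson a u.
Proof. intros Ha. apply Rdiv_lt_0_compat; auto using sum_sqr_pos. Qed.

Lemma poisson_le_inv (a u : R) : 0 < a -> poisson a u <= / a.
Proof.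
intros Ha. assert (h := sum_sqr_pos a u Ha). unfold poisson.
apply Rle_div_l; auto. apply Rmult_le_reg_l with a; auto.
replace (a * (/ a * (u ^ 2 + a ^ 2))) with (u ^ 2 + a ^ 2) by (field; lra). nra.
Qed.

Lemma poisson_bound (a u : R) : 0 < a -> Rabs (poisson a u) <= / a.
Proof.
intros Ha. rewrite Rabs_pos_eq by (left; now apply poisson_pos). now apply poisson_le_inv.
Qed.

Lemma poisson_le_inv_sqr (a u : R) : 0 < a -> u <> 0 -> poisson a u <= a / u ^ 2.
Proof.
intros Ha Hu. assert (0 < u ^ 2) by nra. unfold poisson, Rdiv.
apply Rmult_le_compat_l; [lra|]. apply Rinv_le_contravar; nra.
Qed.

Lemma conj_poisson_bound (a u : R) : 0 < a -> Rabs (conj_poisson a u) <= / a.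
Proof.
intros Ha. assert (h := sum_sqr_pos a u Ha). unfold conj_poisson.
unfold Rdiv. rewrite Rabs_mult, Rabs_inv, (Rabs_pos_eq (u ^ 2 + a ^ 2)) by lra.
apply Rle_div_l; auto. apply Rmult_le_reg_l with a; auto.
replace (a * (/ a * (u ^ 2 + a ^ 2))) with (u ^ 2 + a ^ 2) by (field; lra).
rewrite <- (pow2_abs u). nra.
Qed.

Lemma RInt_poisson (a b c : R) : 0 < a -> RInt (poisson a) b c = atan (c / a) - atan (b / a).
Proof.
intros Ha. apply is_RInt_unique.
apply (is_RInt_derive (fun u => atan (u / a)) (poisson a)).
- intros x _. unfold poisson. auto_derive; auto.
  assert (h := sum_sqr_pos a x Ha). field. split; nra.
- intros x _. now apply continuity_pt_filterlim, poisson_continuity.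
Qed.

Lemma poisson_abs_integrable (a : R) : 0 < a -> abs_integrable (poisson a).
Proof.
intros Ha. split; [now apply poisson_continuity|]. exists PI. intros b c Hbc.
rewrite (RInt_ext _ (poisson a)).
- rewrite RInt_poisson by auto. assert (h1 := atan_bound (c / a)). assert (h2 := atan_bound (b / a)). lra.
- intros x _. apply Rabs_pos_eq. left. now apply poisson_pos.
Qed.

(** The difference is the integral of [poisson 1], whose values lie between 0 and 1. *)
Lemma atan_sub_le (x y : R) : y <= x -> 0 <= atan x - atan y <= x - y.
Proof.
intros H. assert (E := RInt_poisson 1 y x Rlt_0_1).
replace (x / 1) with x in E by field. replace (y / 1) with y in E by field. rewrite <- E.
split.
- apply RInt_nonneg; auto using poisson_continuity, Rlt_0_1.
  intros u. left. apply poisson_pos. lra.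
- replace (x - y) with ((x - y) * 1) by ring. rewrite <- (RInt_const_R 1).
  apply RInt_le_R; auto using poisson_continuity, Rlt_0_1.
  + reg.
  + intros u _. rewrite <- Rinv_1 at 2. apply poisson_le_inv. lra.
Qed.

Lemma atan_abs_sub_le (x y : R) : Rabs (atan x - atan y) <= Rabs (x - y).
Proof.
destruct (Rle_dec y x) as [H|H].
- assert (h := atan_sub_le x y H). rewrite !Rabs_pos_eq; lra.
- assert (h := atan_sub_le y x ltac:(lra)). rewrite !Rabs_left1; lra.
Qed.

Lemma atan_near_PI2 (x : R) : 0 < x -> PI / 2 - / x <= atan x <= PI / 2.
Proof.
intros Hx. assert (h1 := atan_bound x). assert (h2 := atan_inv x Hx).
assert (h3 := atan_sub_le (/ x) 0). rewrite atan_0 in h3.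
assert (0 < / x) by now apply Rinv_0_lt_compat. lra.
Qed.

Lemma Int_poisson (a : R) : 0 < a -> Int (poisson a) = PI.
Proof.
intros Ha. apply is_int_Int. intros eps He.
(* Since pi/2 - atan(t/a) <= a/t, each of the two arctangents is then within eps/2 of its limit. *)
exists (2 * a / eps). assert (M0 : 0 < 2 * a / eps) by (apply Rdiv_lt_0_compat; lra).
split; [lra|]. intros b c Hb Hc. rewrite RInt_poisson by auto.
assert (B : forall t, 2 * a / eps <= t -> PI / 2 - eps / 2 <= atan (t / a) <= PI / 2).
{ intros t Ht. assert (h := atan_near_PI2 (t / a) ltac:(apply Rdiv_lt_0_compat; lra)).
  assert (/ (t / a) <= eps / 2); [|lra].
  replace (/ (t / a)) with (a / t) by (field; lra).
  apply Rle_div_l; [lra|].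
  replace a with (eps / 2 * (2 * a / eps)) by (field; lra).
  apply Rmult_le_compat_l; lra. }
assert (h1 := B c Hc). assert (h2 := B (- b) ltac:(lra)).
replace (- b / a) with (- (b / a)) in h2 by (field; lra). rewrite atan_opp in h2.
apply Rabs_le. lra.
Qed.

(** With P and Q the two kernels, P(x) - P(y) = (Q(x) P(y) + P(x) Q(y)) (y - x). *)
Lemma poisson_Lipschitz (a : R) : 0 < a -> Lipschitz (/ a ^ 2) (poisson a).
Proof.
intros Ha. split. { left. apply Rinv_0_lt_compat. nra. }
intros x y. assert (hx := sum_sqr_pos a x Ha). assert (hy := sum_sqr_pos a y Ha).
replace (poisson a x - poisson a y) with
  ((conj_poisson a x * poisson a y + poisson a x * conj_poisson a y) * (y - x)).
2:{ unfold poisson, conj_poisson. field. lra. }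
rewrite Rabs_mult, (Rabs_minus_sym y x).
apply Rmult_le_compat_r; auto using Rabs_pos.
(* The bound 1/(2a), from 2a|u| <= u^2 + a^2, is twice as good as [conj_poisson_bound]; the two
   products then add up to exactly 1/a^2. *)
assert (HB : forall u, Rabs (conj_poisson a u) <= / (2 * a)).
{ intros u. assert (h := sum_sqr_pos a u Ha). unfold conj_poisson, Rdiv.
  rewrite Rabs_mult, Rabs_inv, (Rabs_pos_eq (u ^ 2 + a ^ 2)) by lra.
  apply Rle_div_l; auto. apply Rmult_le_reg_l with (2 * a); [lra|].
  replace (2 * a * (/ (2 * a) * (u ^ 2 + a ^ 2))) with (u ^ 2 + a ^ 2) by (field; lra).
  rewrite <- (pow2_abs u). assert (h1 := pow2_ge_0 (Rabs u - a)). lra. }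
assert (h1 := HB x). assert (h2 := HB y).
assert (h3 := poisson_bound a x Ha). assert (h4 := poisson_bound a y Ha).
eapply Rle_trans; [apply Rabs_triang|]. rewrite !Rabs_mult.
replace (/ a ^ 2) with (/ (2 * a) * / a + / a * / (2 * a)) by (field; lra).
apply Rplus_le_compat; apply Rmult_le_compat; auto using Rabs_pos.
Qed.

(** For u >= v >= m, ln(u/v) <= u/v - 1 = (u - v)/v, which is 1 + x <= exp x read at x = ln(u/v). *)
Lemma ln_abs_sub_le (x y m : R) : 0 < m -> m <= x -> m <= y ->
  Rabs (ln x - ln y) <= Rabs (x - y) / m.
Proof.
intros Hm.
assert (W : forall u v, m <= v -> v <= u -> 0 <= ln u - ln v <= (u - v) / m).
{ intros u v Hv Huv. split.
  - destruct Huv as [Huv| ->]; [|lra]. assert (h := ln_increasing v u ltac:(lra) Huv). lra.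
  - rewrite <- ln_div by lra.
    apply Rle_trans with (u / v - 1).
    + assert (P : 0 < u / v) by (apply Rdiv_lt_0_compat; lra).
      assert (h := exp_ineq1_le (ln (u / v))). rewrite exp_ln in h by auto. lra.
    + replace (u / v - 1) with ((u - v) / v) by (field; lra).
      unfold Rdiv. apply Rmult_le_compat_l; [lra|]. apply Rinv_le_contravar; lra. }
intros Hx Hy. destruct (Rle_dec y x) as [H|H].
- assert (h := W x y Hy H). rewrite !Rabs_pos_eq; lra.
- assert (h := W y x Hx ltac:(lra)). rewrite (Rabs_left1 (x - y)), Rabs_left1 by lra.
  replace (- (x - y)) with (y - x) by ring. lra.
Qed.

(** The factor 1/t cancels: the integrand equals 4az / (((z - t)^2 + a^2) ((z + t)^2 + a^2)), and
    [Psi] integrates its partial fractions. *)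
Lemma RInt_hilbert_poisson (a z b c : R) : 0 < a -> 0 < b -> b <= c ->
  let Psi t := z / a * (atan ((z + t) / a) - atan ((z - t) / a)) +
    / 2 * (ln ((z + t) ^ 2 + a ^ 2) - ln ((z - t) ^ 2 + a ^ 2)) in
  RInt (fun t => / t * (poisson a (z - t) - poisson a (z + t))) b c =
  poisson a z * (Psi c - Psi b).
Proof.
intros Ha Hb Hbc Psi.
replace (poisson a z * (Psi c - Psi b)) with (poisson a z * Psi c - poisson a z * Psi b) by ring.
apply is_RInt_unique.
apply (is_RInt_derive (fun t => poisson a z * Psi t)).
- intros t Ht. rewrite Rmin_left, Rmax_right in Ht by auto.
  assert (h0 := sum_sqr_pos a z Ha).
  assert (h1 := sum_sqr_pos a (z + t) Ha). assert (h2 := sum_sqr_pos a (z - t) Ha).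
  unfold Psi, poisson. auto_derive.
  + repeat split; auto; simpl in *; lra.
  + field. repeat split; try lra; nra.
- intros t Ht. rewrite Rmin_left, Rmax_right in Ht by auto.
  apply continuity_pt_filterlim.
  apply continuity_pt_mult; [apply continuity_pt_inv; [reg|lra]|].
  assert (C := poisson_continuity a Ha).
  apply (continuity_minus_fun (fun t => poisson a (z - t)) (fun t => poisson a (z + t)));
    auto using continuity_reflect, continuity_translate.
Qed.

(** In the closed form, [Psi] tends to 0 as t tends to 0 and to pi z / a as t tends to infinity (the
    logarithms cancel), and P(z) z / a is the conjugate kernel at z. *)
Lemma is_hilbert_poisson (a : R) : 0 < a -> is_hilbert (poisson a) (conj_poisson a).
Proof.
intros Ha z eps He.
assert (z0 := Rabs_pos z).
(* Sum of four error terms: 4|z| and 8|z| from the arctangents and logarithms at N, then 2|z|/a^2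
   twice from those at 1/N. *)
set (K := 12 * Rabs z + 4 * Rabs z / a ^ 2).
assert (a2 : 0 < a ^ 2) by nra.
assert (HK : 0 <= K).
{ unfold K. apply Rplus_le_le_0_compat; [lra|]. apply Rdiv_le_0_compat; lra. }
assert (c0 := poisson_pos a z Ha).
destruct (exists_large_quotient (poisson a z * K) eps) as [N1 [HN1 Q]]; auto.
{ apply Rmult_le_pos; lra. }
(* The second entry guarantees N - z >= N/2 and N + z >= N/2. *)
exists (Rmax N1 (2 * Rabs z + 1)). intros N HN.
assert (h1 := Rmax_l N1 (2 * Rabs z + 1)). assert (h2 := Rmax_r N1 (2 * Rabs z + 1)).
assert (HN' : 1 <= N) by lra.
destruct (inv_le_self N HN') as [n1 n2].
unfold truncated_hilbert.
rewrite (RInt_ext_R _ (fun t => / t * (poisson a (z - t) - poisson a (z + t)))); auto.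
2:{ intros t Ht. rewrite weight_eq; auto. lra. }
assert (E := RInt_hilbert_poisson a z (/ N) N Ha (proj1 n1) n2). cbv zeta in E. rewrite E. clear E.
assert (hp := PI2_1).
set (A1 := atan ((z + N) / a)). set (A2 := atan ((z - N) / a)).
set (l1 := ln ((z + N) ^ 2 + a ^ 2)). set (l2 := ln ((z - N) ^ 2 + a ^ 2)).
set (A3 := atan ((z + / N) / a) - atan ((z - / N) / a)).
set (l3 := ln ((z + / N) ^ 2 + a ^ 2) - ln ((z - / N) ^ 2 + a ^ 2)).
assert (zl : - Rabs z <= z <= Rabs z) by (apply Rabs_le_between; lra).
assert (B : forall t, N / 2 <= t -> PI / 2 - 2 * a / N <= atan (t / a) <= PI / 2).
{ intros t Ht. assert (h := atan_near_PI2 (t / a) ltac:(apply Rdiv_lt_0_compat; lra)).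
  assert (/ (t / a) <= 2 * a / N); [|lra].
  replace (/ (t / a)) with (a / t) by (field; lra).
  replace (2 * a / N) with (a / (N / 2)) by (field; lra).
  unfold Rdiv at 1 2. apply Rmult_le_compat_l; [lra|]. apply Rinv_le_contravar; lra. }
assert (b1 : PI / 2 - 2 * a / N <= A1 <= PI / 2) by (apply B; lra).
assert (b2 : PI / 2 - 2 * a / N <= - A2 <= PI / 2).
{ unfold A2. rewrite <- atan_opp. replace (- ((z - N) / a)) with ((N - z) / a) by (field; lra).
  apply B; lra. }
assert (b3 : Rabs (A1 - A2 - PI) <= 4 * a / N).
{ replace (4 * a / N) with (2 * (2 * a / N)) by (field; lra). apply Rabs_le. lra. }
assert (b4 : Rabs (l1 - l2) <= 16 * Rabs z / N).
{ eapply Rle_trans; [apply (ln_abs_sub_le _ _ ((N / 2) ^ 2)); nra|].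
  replace ((z + N) ^ 2 + a ^ 2 - ((z - N) ^ 2 + a ^ 2)) with (4 * N * z) by ring.
  rewrite Rabs_mult, (Rabs_pos_eq (4 * N)) by lra. right. field. lra. }
assert (b5 : Rabs A3 <= 2 / a / N).
{ eapply Rle_trans; [apply atan_abs_sub_le|].
  replace ((z + / N) / a - (z - / N) / a) with (2 / a / N) by (field; lra).
  rewrite Rabs_pos_eq; [lra|]. left. repeat apply Rdiv_lt_0_compat; lra. }
assert (b6 : Rabs l3 <= 4 * Rabs z / a ^ 2 / N).
{ assert (s1 := pow2_ge_0 (z + / N)). assert (s2 := pow2_ge_0 (z - / N)).
  eapply Rle_trans; [apply (ln_abs_sub_le _ _ (a ^ 2)); lra|].
  replace ((z + / N) ^ 2 + a ^ 2 - ((z - / N) ^ 2 + a ^ 2)) with (4 / N * z) by (field; lra).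
  rewrite Rabs_mult, (Rabs_pos_eq (4 / N)) by (left; apply Rdiv_lt_0_compat; lra).
  right. field. lra. }
replace (conj_poisson a z) with (/ PI * (poisson a z * (z / a * PI))).
2:{ unfold conj_poisson, poisson. field. assert (h := sum_sqr_pos a z Ha). repeat split; lra. }
rewrite <- Rmult_minus_distr_l, <- Rmult_minus_distr_l, !Rabs_mult.
assert (ip : 0 < / PI) by (apply Rinv_0_lt_compat; lra).
rewrite (Rabs_pos_eq (/ PI)), (Rabs_pos_eq (poisson a z)) by lra.
eapply Rle_trans; [|apply Q].
apply Rle_trans with (1 * (poisson a z * (K / N))).
- apply Rmult_le_compat; auto using Rabs_pos.
  + lra.
  + apply Rmult_le_pos; auto using Rabs_pos; lra.
  + rewrite <- Rinv_1. apply Rinv_le_contravar; lra.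
  + apply Rmult_le_compat_l; [lra|].
    replace (_ - z / a * PI) with (z / a * (A1 - A2 - PI) + / 2 * (l1 - l2) +
      - (z / a * A3) + - (/ 2 * l3)) by ring.
    eapply Rle_trans; [apply Rabs_triang|]. rewrite Rabs_Ropp, Rabs_mult, (Rabs_pos_eq (/ 2)) by lra.
    eapply Rle_trans; [apply Rplus_le_compat_r, Rabs_triang|].
    rewrite Rabs_Ropp, Rabs_mult.
    eapply Rle_trans; [apply Rplus_le_compat_r, Rplus_le_compat_r, Rabs_triang|].
    rewrite !Rabs_mult, (Rabs_pos_eq (/ 2)) by lra.
    unfold Rdiv at 1 2. rewrite Rabs_mult, Rabs_inv, (Rabs_pos_eq a) by lra.
    assert (za : 0 <= Rabs z * / a) by (apply Rmult_le_pos; [lra|left; now apply Rinv_0_lt_compat]).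
    replace (K / N) with (Rabs z * / a * (4 * a / N) + / 2 * (16 * Rabs z / N) +
      Rabs z * / a * (2 / a / N) + / 2 * (4 * Rabs z / a ^ 2 / N)) by (unfold K; field; lra).
    repeat apply Rplus_le_compat; apply Rmult_le_compat_l; auto; lra.
- rewrite Rmult_1_l. unfold Rdiv. rewrite <- Rmult_assoc. apply Rmult_le_compat_l.
  + apply Rmult_le_pos; lra.
  + apply Rinv_le_contravar; lra.
Qed.

(** The kernel has mass pi and concentrates at 0. Here [f] need only be integrable, so away from [x]
    the part with f(y) uses a sup bound on the kernel, and the part with f(x) an integrable
    bound. *)
Lemma poisson_approximation (f : R -> R) (x eps : R) : abs_integrable f -> 0 < eps ->
  exists a0, 0 < a0 /\ forall a, 0 < a -> a <= a0 ->
    Rabs (conv f (poisson a) x - PI * f x) <= eps.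
Proof.
intros Hf He. assert (Cf := proj1 Hf). assert (hp := PI2_1). assert (hp4 := PI_4).
destruct (continuity_pt_lt f x (eps / 8) (Cf x)) as [d [Hd Hcont]]; [lra|].
assert (d2 : 0 < d ^ 2) by nra.
set (C := 1 + / d ^ 2).
assert (C1 : / d ^ 2 <= C) by (unfold C; lra).
assert (id2 : 0 < / d ^ 2) by now apply Rinv_0_lt_compat.
assert (f0 := norm1_nonneg f Hf). assert (fx := Rabs_pos (f x)).
set (K := C * (norm1 f + Rabs (f x) * PI)).
assert (HK : 0 <= K). { unfold K. apply Rmult_le_pos; [lra|]. nra. }
exists (eps / (2 * (K + 1))). split. { apply Rdiv_lt_0_compat; lra. }
intros a Ha Ha0.
assert (IP := poisson_abs_integrable a Ha).
assert (IP' := abs_integrable_reflect _ x IP).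
assert (I1 := abs_integrable_reflect _ x (poisson_abs_integrable 1 Rlt_0_1)).
assert (If := abs_integrable_conv f (poisson a) x (/ a) Hf (proj1 IP)
   (fun y => poisson_bound a y Ha)).
rewrite <- (Int_poisson a Ha), <- (Int_reflect (poisson a) x IP), (Rmult_comm _ (f x)).
unfold conv. rewrite <- Int_scal, <- Int_minus; auto using abs_integrable_scal.
(* One majorant valid near and far from [x], so that the integral is never split. For |u| >= d, the
   kernel P_a(u) is at most a/u^2, hence at most both aC and aC P_1(u), because C u^2 >= u^2 + 1. *)
set (D := fun y => eps / 8 * poisson a (x - y) +
   a * C * (Rabs (f y) + Rabs (f x) * poisson 1 (x - y))).
assert (J1 : abs_integrable (fun y => Rabs (f y) + Rabs (f x) * poisson 1 (x - y))).
{ apply abs_integrable_plus; auto using abs_integrable_abs, abs_integrable_scal. }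
assert (ID : Int D = eps / 8 * PI + a * K).
{ unfold D. rewrite Int_plus, !Int_scal, Int_plus, Int_scal;
    auto using abs_integrable_scal, abs_integrable_abs.
  rewrite !(Int_reflect (poisson _)), !Int_poisson; auto using poisson_abs_integrable, Rlt_0_1.
  unfold K, norm1. ring. }
apply Rle_trans with (Int D).
- apply Int_abs_le.
  + apply continuity_minus_fun; [apply If|]. now apply (abs_integrable_scal (f x)).
  + apply abs_integrable_plus; auto using abs_integrable_scal.
  + intros y. rewrite <- Rmult_minus_distr_r, Rabs_mult.
    assert (Pp := poisson_pos a (x - y) Ha). rewrite (Rabs_pos_eq (poisson a (x - y))) by lra.
    assert (P1 := poisson_pos 1 (x - y) Rlt_0_1).
    assert (fy := Rabs_pos (f y)).
    unfold D. destruct (Rlt_dec (Rabs (y - x)) d) as [Hy|Hy].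
    * specialize (Hcont y Hy).
      apply Rle_trans with (eps / 8 * poisson a (x - y)).
      { apply Rmult_le_compat_r; lra. }
      assert (0 <= a * C * (Rabs (f y) + Rabs (f x) * poisson 1 (x - y))); [|lra].
      apply Rmult_le_pos; [apply Rmult_le_pos; unfold C; lra|].
      apply Rplus_le_le_0_compat; auto. apply Rmult_le_pos; lra.
    * assert (Hu : d ^ 2 <= (x - y) ^ 2).
      { rewrite <- (pow2_abs (x - y)), Rabs_minus_sym. apply pow_incr. lra. }
      assert (Pq := poisson_le_inv_sqr a (x - y) Ha ltac:(intros h; rewrite h in Hu; lra)).
      set (u := x - y) in *.
      assert (Q1 : a / u ^ 2 <= a * C).
      { unfold Rdiv. apply Rmult_le_compat_l; [lra|].
        apply Rle_trans with (/ d ^ 2); auto. apply Rinv_le_contravar; auto. }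
      assert (Q2 : a / u ^ 2 <= a * C * poisson 1 u).
      { unfold poisson. apply Rle_div_l; [lra|].
        replace (a * C * (1 / (u ^ 2 + 1 ^ 2)) * u ^ 2) with
          (a * (C * u ^ 2 / (u ^ 2 + 1))) by (field; nra).
        rewrite <- (Rmult_1_r a) at 1. apply Rmult_le_compat_l; [lra|].
        apply Rle_div_r; [nra|]. unfold C.
        assert (1 <= / d ^ 2 * u ^ 2); [|lra].
        rewrite <- (Rinv_l (d ^ 2)) by lra. apply Rmult_le_compat_l; lra. }
      assert (T : Rabs (f y - f x) <= Rabs (f y) + Rabs (f x)).
      { unfold Rminus. eapply Rle_trans; [apply Rabs_triang|]. rewrite Rabs_Ropp. lra. }
      assert (0 <= eps / 8 * poisson a u) by (apply Rmult_le_pos; lra).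
      apply Rle_trans with ((Rabs (f y) + Rabs (f x)) * poisson a u).
      { apply Rmult_le_compat_r; lra. }
      assert (Rabs (f y) * poisson a u <= Rabs (f y) * (a * C)) by (apply Rmult_le_compat_l; lra).
      assert (Rabs (f x) * poisson a u <= Rabs (f x) * (a * C * poisson 1 u))
        by (apply Rmult_le_compat_l; lra).
      lra.
- rewrite ID. assert (a * K <= eps / 2); [|nra].
  apply Rle_trans with (eps / (2 * (K + 1)) * (K + 1)).
  + apply Rmult_le_compat; lra.
  + right. field. lra.
Qed.

(** * Band-limited functions *)

(** The real part of e^(2 pi i x xi) times the Fourier transform at [xi], that is, the frequency
    [xi] contribution to f(x) in the inversion formula. *)
Definition cosine_conv (f : R -> R) (x xi : R) : R := conv f (fun u => cos (2 * PI * u * xi)) x.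

Definition cosine_kernel (w : R -> R) (a b u : R) : R :=
  RInt (fun xi => w xi * cos (2 * PI * u * xi)) a b.

Lemma Rabs_cos_le_1 (x : R) : Rabs (cos x) <= 1.
Proof. apply Rabs_le. apply COS_bound. Qed.

Lemma cos_abs_sub_le (x y : R) : Rabs (cos x - cos y) <= Rabs (x - y).
Proof.
rewrite <- (Rmult_1_l (Rabs (x - y))).
apply (bounded_variation cos (fun t => - sin t)). intros t _. split.
- apply is_derive_Reals, derivable_pt_lim_cos.
- rewrite Rabs_Ropp. apply Rabs_le, SIN_bound.
Qed.

Lemma cosine_continuity (xi : R) : continuity (fun u => cos (2 * PI * u * xi)).
Proof. reg. Qed.

Lemma cosine_continuous2 (w : R -> R) : continuity w ->
  continuous2 (fun u xi => w xi * cos (2 * PI * u * xi)).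
Proof.
intros Cw. apply continuous2_mult.
- apply (continuous2_comp w (fun _ xi => xi)); auto using continuous2_snd.
- apply (continuous2_comp cos (fun u xi => 2 * PI * u * xi)).
  + apply continuity_cos.
  + apply (continuous2_mult (fun u _ => 2 * PI * u)); auto using continuous2_snd.
    apply (continuous2_mult (fun _ _ => 2 * PI)); auto using continuous2_const, continuous2_fst.
Qed.

Lemma cosine_kernel_continuity (w : R -> R) (a b : R) : continuity w -> a <= b ->
  continuity (cosine_kernel w a b).
Proof.
intros Cw Hab.
apply (continuity_RInt_param (fun xi u => w xi * cos (2 * PI * u * xi))); auto.
apply (continuous2_swap (fun u xi => w xi * cos (2 * PI * u * xi))).
now apply cosine_continuous2.
Qed.

Lemma cosine_integrand_continuity (w : R -> R) (u : R) : continuity w ->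
  continuity (fun xi => w xi * cos (2 * PI * u * xi)).
Proof.
intros Cw. apply (continuous2_section (fun u xi => w xi * cos (2 * PI * u * xi))).
now apply cosine_continuous2.
Qed.

Lemma cosine_kernel_bound (w : R -> R) (a b W u : R) : continuity w -> a <= b ->
  (forall xi, Rabs (w xi) <= W) -> Rabs (cosine_kernel w a b u) <= (b - a) * W.
Proof.
intros Cw Hab HW. apply abs_RInt_le_const; auto.
- now apply continuity_ex_RInt, cosine_integrand_continuity.
- intros xi _. rewrite Rabs_mult, <- (Rmult_1_r W).
  apply Rmult_le_compat; auto using Rabs_pos, Rabs_cos_le_1.
Qed.

(** By Fubini, convolution with the inverse cosine transform of [w] multiplies frequencies by [w].
    Continuity in [xi] comes from the same domination by W |f|. *)
Lemma conv_cosine_kernel (f w : R -> R) (a b W x : R) : abs_integrable f -> continuity w ->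
  (forall xi, Rabs (w xi) <= W) -> a <= b ->
  continuity (fun xi => w xi * cosine_conv f x xi) /\
  conv f (cosine_kernel w a b) x = RInt (fun xi => w xi * cosine_conv f x xi) a b.
Proof.
intros Hf Cw HW Hab.
set (F := fun y xi => f y * (w xi * cos (2 * PI * (x - y) * xi))).
assert (CF : continuous2 F).
{ apply (continuous2_mult (fun y _ => f y)).
  - apply (continuous2_comp f (fun y _ => y)); [apply Hf|apply continuous2_fst].
  - intros y xi.
    apply (continuity_2d_pt_ext (fun y xi => w xi * cos (2 * PI * x * xi - 2 * PI * y * xi))).
    { intros u v. do 2 f_equal. ring. }
    apply (continuous2_mult (fun _ xi => w xi)).
    + apply (continuous2_comp w (fun _ xi => xi)); auto using continuous2_snd.
    + apply (continuous2_comp cos (fun y xi => 2 * PI * x * xi - 2 * PI * y * xi));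
        [apply continuity_cos|].
      apply (continuous2_minus (fun _ xi => 2 * PI * x * xi) (fun y xi => 2 * PI * y * xi)).
      * apply (continuous2_mult (fun _ _ => 2 * PI * x)); auto using continuous2_const, continuous2_snd.
      * apply (continuous2_mult (fun y _ => 2 * PI * y)); auto using continuous2_snd.
        apply (continuous2_mult (fun _ _ => 2 * PI)); auto using continuous2_const, continuous2_fst. }
assert (DF : forall y xi, Rabs (F y xi) <= W * Rabs (f y)).
{ intros y xi. unfold F. rewrite !Rabs_mult, Rmult_comm.
  apply Rmult_le_compat_r; auto using Rabs_pos.
  rewrite <- (Rmult_1_r W). apply Rmult_le_compat; auto using Rabs_pos, Rabs_cos_le_1. }
assert (DG : abs_integrable (fun y => W * Rabs (f y))).
{ now apply abs_integrable_scal, abs_integrable_abs. }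
assert (E : forall xi, Int (fun y => F y xi) = w xi * cosine_conv f x xi).
{ intros xi. unfold cosine_conv, conv. rewrite <- Int_scal.
  - apply Int_ext. intros y. unfold F. ring.
  - apply (abs_integrable_conv f (fun u => cos (2 * PI * u * xi)) x 1); auto using cosine_continuity.
    intros; apply Rabs_cos_le_1. }
split.
- intros xi. apply (continuity_pt_ext (fun xi => Int (fun y => F y xi))); auto.
  now apply (continuity_Int_param F (fun y => W * Rabs (f y))).
- rewrite <- (RInt_ext (fun xi => Int (fun y => F y xi))) by auto.
  rewrite <- (Int_Fubini F (fun y => W * Rabs (f y))) by auto.
  apply Int_ext. intros y. unfold F, cosine_kernel.
  now rewrite RInt_scal_R by now apply cosine_integrand_continuity.
Qed.

Lemma cosine_conv_bound (f : R -> R) (x xi : R) : abs_integrable f ->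
  Rabs (cosine_conv f x xi) <= norm1 f.
Proof.
intros Hf. rewrite <- (Rmult_1_l (norm1 f)).
apply conv_abs_le; auto using cosine_continuity. intros; apply Rabs_cos_le_1.
Qed.

Lemma cosine_conv_continuity (f : R -> R) (x : R) : abs_integrable f ->
  continuity (cosine_conv f x).
Proof.
intros Hf.
destruct (conv_cosine_kernel f (fun _ => 1) 0 1 1 x Hf) as [C _].
- apply continuity_const. now intros ? ?.
- intros _. rewrite Rabs_R1. lra.
- lra.
- intros xi. apply (continuity_pt_ext (fun xi => 1 * cosine_conv f x xi)); auto.
  intros; ring.
Qed.

Lemma cosine_conv_Lipschitz (f : R -> R) (x y xi : R) : abs_integrable f -> 0 <= xi <= 1 ->
  Rabs (cosine_conv f x xi - cosine_conv f y xi) <= 2 * PI * norm1 f * Rabs (x - y).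
Proof.
intros Hf Hxi. assert (hp := PI2_1).
assert (A : forall z, abs_integrable (fun u => f u * cos (2 * PI * (z - u) * xi))).
{ intros z. apply (abs_integrable_conv f (fun u => cos (2 * PI * u * xi)) z 1);
    auto using cosine_continuity. intros; apply Rabs_cos_le_1. }
unfold cosine_conv, conv. rewrite <- Int_minus by auto.
replace (2 * PI * norm1 f * Rabs (x - y)) with ((2 * PI * Rabs (x - y)) * norm1 f) by ring.
unfold norm1. rewrite <- Int_scal by now apply abs_integrable_abs.
apply Int_abs_le.
- now apply abs_integrable_minus.
- now apply abs_integrable_scal, abs_integrable_abs.
- intros u. rewrite <- Rmult_minus_distr_l, Rabs_mult, Rmult_comm.
  apply Rmult_le_compat_r; auto using Rabs_pos.
  eapply Rle_trans; [apply cos_abs_sub_le|].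
  replace (2 * PI * (x - u) * xi - 2 * PI * (y - u) * xi) with (2 * PI * (x - y) * xi) by ring.
  rewrite !Rabs_mult, (Rabs_pos_eq 2), (Rabs_pos_eq PI), (Rabs_pos_eq xi) by lra.
  assert (h := Rabs_pos (x - y)).
  rewrite <- (Rmult_1_r (2 * PI * Rabs (x - y))) at 2. apply Rmult_le_compat_l; [|lra].
  apply Rmult_le_pos; lra.
Qed.

(** Negative frequencies are covered because [cosine_conv] is even in [xi]; letting [x] vary
    captures both the cosine and the sine transform. *)
Definition band_limited (f : R -> R) : Prop := forall x xi, 1 < xi -> cosine_conv f x xi = 0.

(** The Abel weight produces the Poisson kernel, up to a remainder carrying exp(-2 pi a L). The
    absolute value in the weight keeps it bounded by 1 on the whole line, as [conv_cosine_kernel]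
    requires. *)
Lemma exp_kernel (a L u : R) : 0 < a -> 0 <= L ->
  cosine_kernel (fun xi => exp (- (2 * PI * a) * Rabs xi)) 0 L u =
  / (2 * PI) * poisson a u - exp (- (2 * PI * a) * L) *
   (/ (2 * PI) * (poisson a u * cos (2 * PI * u * L) - conj_poisson a u * sin (2 * PI * u * L))).
Proof.
intros Ha HL. assert (hp := PI2_1). assert (hs := sum_sqr_pos a u Ha). unfold cosine_kernel.
rewrite (RInt_ext_R _ (fun xi => exp (- (2 * PI * a) * xi) * cos (2 * PI * u * xi))); auto.
2:{ intros xi Hxi. rewrite Rabs_pos_eq; lra. }
set (G := fun xi => exp (- (2 * PI * a) * xi) * (/ (2 * PI) *
  (conj_poisson a u * sin (2 * PI * u * xi) - poisson a u * cos (2 * PI * u * xi)))).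
transitivity (G L - G 0).
2:{ unfold G. rewrite !Rmult_0_r, sin_0, cos_0, exp_0. ring. }
apply is_RInt_unique.
apply (is_RInt_derive G).
- intros xi _. unfold G. auto_derive; auto. unfold poisson, conj_poisson.
  field. repeat split; lra.
- intros xi _. apply continuity_pt_filterlim.
  assert (C : continuity (fun xi => exp (- (2 * PI * a) * xi) * cos (2 * PI * u * xi))) by reg.
  apply C.
Qed.

Lemma exp_neg_le_inv (t : R) : 0 < t -> exp (- t) <= / t.
Proof.
intros Ht. rewrite exp_Ropp. apply Rinv_le_contravar; auto.
assert (h := exp_ineq1_le t). lra.
Qed.

(** The band limit allows the upper end 1 to be replaced by any L >= 1 without changing the left
    side; as L tends to infinity the cosine kernel tends uniformly to 1/(2 pi) times the Poisson
    kernel. *)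
Lemma abel_mean_band_limited (f : R -> R) (a x : R) : abs_integrable f -> band_limited f ->
  0 < a -> RInt (fun xi => exp (- (2 * PI * a) * Rabs xi) * cosine_conv f x xi) 0 1 =
  / (2 * PI) * conv f (poisson a) x.
Proof.
intros Hf Hb Ha. assert (hp := PI2_1). assert (f0 := norm1_nonneg f Hf).
assert (Pa : 0 < 2 * PI * a) by (apply Rmult_lt_0_compat; lra).
set (w := fun xi => exp (- (2 * PI * a) * Rabs xi)).
assert (Cw : continuity w).
{ apply (continuity_comp_fun exp (fun xi => - (2 * PI * a) * Rabs xi)).
  - apply derivable_continuous, derivable_exp.
  - apply (continuity_scal_fun _ Rabs), Rcontinuity_abs. }
assert (Bw : forall xi, Rabs (w xi) <= 1).
{ intros xi. unfold w. rewrite Rabs_pos_eq by (left; apply exp_pos).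
  rewrite <- exp_0. assert (h := Rabs_pos xi).
  assert (- (2 * PI * a) * Rabs xi <= 0) by nra.
  destruct (Req_dec (- (2 * PI * a) * Rabs xi) 0) as [->|]; [lra|].
  left. apply exp_increasing. lra. }
apply cond_eq. intros eps He.
(* From the remainder in [exp_kernel]: the bracket is at most 2/a, the exponential at most 1/(2 pi a
   L), and the factor 1/(2 pi) at most 1. *)
set (C := norm1 f * (2 / a * / (2 * PI * a))).
assert (C0 : 0 <= C).
{ apply Rmult_le_pos; auto. apply Rmult_le_pos.
  - apply Rdiv_le_0_compat; lra.
  - left. now apply Rinv_0_lt_compat. }
destruct (exists_large_quotient C (eps / 2)) as [L [HL Q]]; auto; [lra|].
destruct (conv_cosine_kernel f w 0 L 1 x Hf Cw Bw ltac:(lra)) as [CI E].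
assert (E1 : RInt (fun xi => w xi * cosine_conv f x xi) 0 1 =
  conv f (cosine_kernel w 0 L) x).
{ rewrite E, <- (RInt_Chasles_R _ 0 1 L) by auto.
  rewrite (RInt_ext_R (fun xi => w xi * cosine_conv f x xi) (fun _ => 0) 1 L); auto.
  - now rewrite RInt_const_R, Rmult_0_r, Rplus_0_r.
  - intros xi Hxi. rewrite Hb by lra. ring. }
change (Rabs (RInt (fun xi => w xi * cosine_conv f x xi) 0 1 -
  / (2 * PI) * conv f (poisson a) x) < eps).
rewrite E1.
assert (IP := abs_integrable_conv f (poisson a) x (/ a) Hf (poisson_continuity a Ha)
  (fun y => poisson_bound a y Ha)).
assert (CK := cosine_kernel_continuity w 0 L Cw ltac:(lra)).
assert (IK := abs_integrable_conv f (cosine_kernel w 0 L) x ((L - 0) * 1) Hf CK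
  (fun y => cosine_kernel_bound w 0 L 1 y Cw ltac:(lra) Bw)).
unfold conv. rewrite <- Int_scal, <- Int_minus by auto using abs_integrable_scal.
apply Rle_lt_trans with (eps / 2); [|lra].
eapply Rle_trans; [|apply Q].
assert (D : forall u, Rabs (cosine_kernel w 0 L u - / (2 * PI) * poisson a u) <=
  2 / a * / (2 * PI * a) / L).
{ intros u. unfold w. rewrite exp_kernel by lra.
  replace (_ - _) with (- (exp (- (2 * PI * a) * L) *
   (/ (2 * PI) * (poisson a u * cos (2 * PI * u * L) - conj_poisson a u * sin (2 * PI * u * L)))))
   by ring.
  rewrite Rabs_Ropp, !Rabs_mult, (Rabs_pos_eq (exp _)) by (left; apply exp_pos).
  assert (ip : 0 < / (2 * PI)) by (apply Rinv_0_lt_compat; lra).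
  rewrite (Rabs_pos_eq (/ (2 * PI))) by lra.
  replace (2 / a * / (2 * PI * a) / L) with (/ (2 * PI * a * L) * (1 * (2 / a))) by (field; lra).
  apply Rmult_le_compat.
  - left; apply exp_pos.
  - apply Rmult_le_pos; [lra|apply Rabs_pos].
  - replace (- (2 * PI * a) * L) with (- (2 * PI * a * L)) by ring.
    apply exp_neg_le_inv. apply Rmult_lt_0_compat; lra.
  - apply Rmult_le_compat; auto using Rabs_pos; [lra| |].
    + rewrite <- Rinv_1. apply Rinv_le_contravar; lra.
    + unfold Rminus. eapply Rle_trans; [apply Rabs_triang|].
      rewrite Rabs_Ropp, !Rabs_mult.
      replace (2 / a) with (/ a * 1 + / a * 1) by (field; lra).
      apply Rplus_le_compat; apply Rmult_le_compat; auto using Rabs_pos, Rabs_cos_le_1,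
        poisson_bound, conj_poisson_bound.
      apply Rabs_le, SIN_bound. }
replace (C / L) with (2 / a * / (2 * PI * a) / L * norm1 f) by (unfold C; field; lra).
unfold norm1. rewrite <- Int_scal by now apply abs_integrable_abs.
apply Int_abs_le.
- apply abs_integrable_minus; auto using abs_integrable_scal.
- now apply abs_integrable_scal, abs_integrable_abs.
- intros y. replace (_ - _) with
   (f y * (cosine_kernel w 0 L (x - y) - / (2 * PI) * poisson a (x - y))) by ring.
  rewrite Rabs_mult, Rmult_comm. apply Rmult_le_compat_r; auto using Rabs_pos.
Qed.

(** Let a tend to 0 in the Abel identity. On [0, 1] the weight differs from 1 by at most 2 pi a, and
    the Poisson side tends to f(x)/2. *)
Lemma band_limited_inversion (f : R -> R) (x : R) : abs_integrable f -> band_limited f ->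
  f x = 2 * RInt (cosine_conv f x) 0 1.
Proof.
intros Hf Hb. assert (hp := PI2_1). assert (f0 := norm1_nonneg f Hf).
apply cond_eq. intros eps He.
destruct (poisson_approximation f x (eps / 4)) as [a0 [Ha0 H]]; auto; [lra|].
set (K := 2 * PI * norm1 f).
assert (K0 : 0 <= K) by (unfold K; apply Rmult_le_pos; lra).
set (a := Rmin a0 (eps / (8 * (K + 1)))).
assert (h1 := Rmin_l a0 (eps / (8 * (K + 1)))). assert (h2 := Rmin_r a0 (eps / (8 * (K + 1)))).
assert (Ha : 0 < a). { apply Rmin_glb_lt; auto. apply Rdiv_lt_0_compat; lra. }
fold a in h1, h2.
specialize (H a Ha h1).
assert (Cc := cosine_conv_continuity f x Hf).
assert (Ce : continuity (fun xi => exp (- (2 * PI * a) * Rabs xi) * cosine_conv f x xi)).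
{ apply continuity_mult_fun; auto.
  apply (continuity_comp_fun exp (fun xi => - (2 * PI * a) * Rabs xi)).
  - apply derivable_continuous, derivable_exp.
  - apply (continuity_scal_fun _ Rabs), Rcontinuity_abs. }
assert (D : Rabs (RInt (cosine_conv f x) 0 1 - / (2 * PI) * conv f (poisson a) x) <= eps / 8).
{ rewrite <- abel_mean_band_limited by auto. rewrite <- RInt_minus_R by auto.
  apply Rle_trans with ((1 - 0) * (K * a)).
  - apply abs_RInt_le_const; [lra|now apply continuity_ex_RInt, continuity_minus_fun|].
    intros t Ht. rewrite (Rabs_pos_eq t) by lra.
    replace (_ - _) with (cosine_conv f x t * (1 - exp (- (2 * PI * a) * t))) by ring.
    assert (e1 := exp_ineq1_le (- (2 * PI * a) * t)).
    assert (pa : 0 <= 2 * PI * a) by (apply Rmult_le_pos; lra).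
    assert (e2 : exp (- (2 * PI * a) * t) <= 1).
    { rewrite <- exp_0. destruct (Req_dec (- (2 * PI * a) * t) 0) as [->|]; [lra|].
      left. apply exp_increasing. nra. }
    rewrite Rabs_mult, (Rabs_pos_eq (1 - _)) by lra.
    replace (K * a) with (norm1 f * (2 * PI * a)) by (unfold K; ring).
    apply Rmult_le_compat; auto using Rabs_pos, cosine_conv_bound; [lra|].
    assert (2 * PI * a * t <= 2 * PI * a * 1) by (apply Rmult_le_compat_l; lra). lra.
  - rewrite Rminus_0_r, Rmult_1_l.
    apply Rle_trans with ((K + 1) * (eps / (8 * (K + 1)))).
    + apply Rmult_le_compat; lra.
    + right; field; lra. }
assert (E : Rabs (/ (2 * PI) * conv f (poisson a) x - f x / 2) <= eps / 4).
{ replace (_ - _) with (/ (2 * PI) * (conv f (poisson a) x - PI * f x)) by (field; lra).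
  assert (ip : 0 < / (2 * PI) <= 1).
  { split; [apply Rinv_0_lt_compat; lra|]. rewrite <- Rinv_1. apply Rinv_le_contravar; lra. }
  rewrite Rabs_mult, (Rabs_pos_eq (/ _)) by lra.
  assert (p := Rabs_pos (conv f (poisson a) x - PI * f x)). nra. }
apply Rabs_le_between in D. apply Rabs_le_between in E.
apply Rabs_lt_between. lra.
Qed.

Lemma band_limited_bound (f : R -> R) (x : R) : abs_integrable f -> band_limited f ->
  Rabs (f x) <= 2 * norm1 f.
Proof.
intros Hf Hb. rewrite (band_limited_inversion f x Hf Hb), Rabs_mult, (Rabs_pos_eq 2) by lra.
apply Rmult_le_compat_l; [lra|].
replace (norm1 f) with ((1 - 0) * norm1 f) by ring.
apply abs_RInt_le_const; [lra| |].
- now apply continuity_ex_RInt, cosine_conv_continuity.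
- intros; now apply cosine_conv_bound.
Qed.

(** The inversion formula is Lipschitz in [x] because its frequencies are at most 1. This is the
    source of uniform convergence of the truncated Hilbert transforms. *)
Lemma band_limited_Lipschitz (f : R -> R) : abs_integrable f -> band_limited f ->
  Lipschitz (4 * PI * norm1 f) f.
Proof.
intros Hf Hb. assert (hp := PI2_1). assert (f0 := norm1_nonneg f Hf). split.
- apply Rmult_le_pos; lra.
- intros x y. rewrite (band_limited_inversion f x), (band_limited_inversion f y) by auto.
  rewrite <- Rmult_minus_distr_l, <- RInt_minus_R by auto using cosine_conv_continuity.
  rewrite Rabs_mult, (Rabs_pos_eq 2) by lra.
  replace (4 * PI * norm1 f * Rabs (x - y)) with
    (2 * ((1 - 0) * (2 * PI * norm1 f * Rabs (x - y)))) by ring.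
  apply Rmult_le_compat_l; [lra|].
  apply abs_RInt_le_const; [lra| |].
  + apply continuity_ex_RInt, continuity_minus_fun; now apply cosine_conv_continuity.
  + intros; now apply cosine_conv_Lipschitz.
Qed.

(* On [0, 2] this is twice the trapezoid equal to 1 on [0, 1] and descending linearly to 0 at 2, so that its cosine kernel is of de la Vallee Poussin type. *)
Definition trapezoid (xi : R) : R := 2 * Rmin 1 (Rabs (2 - xi)).

Definition reproducing_kernel : R -> R := cosine_kernel trapezoid 0 2.

Lemma trapezoid_continuity : continuity trapezoid.
Proof.
unfold trapezoid. apply continuity_scal_fun. intros t.
apply continuity_pt_ext with (fun xi => (1 + Rabs (2 - xi) - Rabs (1 - Rabs (2 - xi))) * / 2).
{ intros xi. unfold Rmin. destruct (Rle_dec 1 (Rabs (2 - xi))).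
  - rewrite (Rabs_left1 (1 - _)) by lra. lra.
  - rewrite (Rabs_pos_eq (1 - _)) by lra. lra. }
assert (C : continuity (fun xi => Rabs (2 - xi))) by (apply (continuity_abs_fun (fun xi => 2 - xi)); reg).
apply (continuity_mult_fun (fun xi => 1 + Rabs (2 - xi) - Rabs (1 - Rabs (2 - xi))) (fun _ => / 2)).
- apply (continuity_minus_fun (fun xi => 1 + Rabs (2 - xi))).
  + apply (continuity_plus_fun (fun _ => 1)); auto. reg.
  + apply (continuity_abs_fun (fun xi => 1 - Rabs (2 - xi))).
    apply (continuity_minus_fun (fun _ => 1)); auto. reg.
- reg.
Qed.

Lemma trapezoid_bound (xi : R) : Rabs (trapezoid xi) <= 2.
Proof.
unfold trapezoid. assert (h1 := Rmin_l 1 (Rabs (2 - xi))). assert (h := Rabs_pos (2 - xi)).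
assert (h2 : 0 <= Rmin 1 (Rabs (2 - xi))) by (apply Rmin_glb; lra).
rewrite Rabs_pos_eq; lra.
Qed.

Lemma reproducing_kernel_continuity : continuity reproducing_kernel.
Proof. apply cosine_kernel_continuity; [apply trapezoid_continuity|lra]. Qed.

Lemma reproducing_kernel_bound (u : R) : Rabs (reproducing_kernel u) <= 4.
Proof.
replace 4 with ((2 - 0) * 2) by ring.
apply cosine_kernel_bound; auto using trapezoid_continuity, trapezoid_bound. lra.
Qed.

(** The terms of order 1/u cancel at frequency 1, where the trapezoid is continuous, and vanish at
    2, where it is 0; what remains decays like u^-2. *)
Lemma reproducing_kernel_eq (u : R) : u <> 0 ->
  reproducing_kernel u =
  2 * (cos (2 * PI * u) - cos (2 * (2 * PI * u))) / (2 * PI * u) ^ 2.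
Proof.
intros Hu. assert (hp := PI2_1).
set (o := 2 * PI * u). assert (Ho : o <> 0) by (apply Rmult_integral_contrapositive; lra).
unfold reproducing_kernel, cosine_kernel. fold o.
assert (CI := cosine_integrand_continuity trapezoid u trapezoid_continuity). fold o in CI.
rewrite <- (RInt_Chasles_R _ 0 1 2) by auto.
rewrite (RInt_ext_R _ (fun xi => 2 * cos (o * xi)) 0 1) by
 (try lra; intros xi Hxi; unfold trapezoid; rewrite (Rabs_pos_eq (2 - xi)), Rmin_left by lra; ring).
rewrite (RInt_ext_R (fun xi => trapezoid xi * cos (o * xi))
   (fun xi => 2 * (2 - xi) * cos (o * xi)) 1 2) by
 (try lra; intros xi Hxi; unfold trapezoid; rewrite (Rabs_pos_eq (2 - xi)), Rmin_right by lra; ring).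
rewrite (is_RInt_unique _ _ _ (2 * sin (o * 1) / o - 2 * sin (o * 0) / o)).
2:{ apply (is_RInt_derive (fun xi => 2 * sin (o * xi) / o)).
  - intros xi _. auto_derive; auto. field; auto.
  - intros xi _. apply continuity_pt_filterlim.
    assert (C : continuity (fun xi => 2 * cos (o * xi))) by reg. apply C. }
set (G := fun xi => 2 * (2 - xi) * sin (o * xi) / o - 2 * cos (o * xi) / o ^ 2).
rewrite (is_RInt_unique (fun xi => 2 * (2 - xi) * cos (o * xi)) _ _ (G 2 - G 1)).
2:{ apply (is_RInt_derive G).
  - intros xi _. unfold G. auto_derive; auto. field; auto.
  - intros xi _. apply continuity_pt_filterlim.
    assert (C : continuity (fun xi => 2 * (2 - xi) * cos (o * xi))) by reg. apply C. }
unfold G. rewrite Rmult_0_r, sin_0, Rmult_1_r, (Rmult_comm o 2). field. auto.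
Qed.

Lemma reproducing_kernel_abs_integrable : abs_integrable reproducing_kernel.
Proof.
(* The kernel is at most 4 min(1, u^-2), and u^2 + 1 <= 2 max(1, u^2), whence 8. *)
apply abs_integrable_dom with (poisson 1) 8.
- apply reproducing_kernel_continuity.
- apply poisson_abs_integrable; lra.
- intros u. assert (hp := PI2_3_2).
  rewrite (Rabs_pos_eq (poisson 1 u)) by (left; apply poisson_pos; lra).
  assert (hs := sum_sqr_pos 1 u Rlt_0_1).
  unfold poisson. replace (8 * (1 / (u ^ 2 + 1 ^ 2))) with (8 / (u ^ 2 + 1 ^ 2)) by (field; lra).
  destruct (Rle_dec (u ^ 2) 1) as [H|H].
  + eapply Rle_trans; [apply reproducing_kernel_bound|].
    apply (Rle_div_r 4 8 (u ^ 2 + 1 ^ 2)); lra.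
  + assert (Hu : u <> 0) by (intros ->; lra).
    rewrite reproducing_kernel_eq by auto.
    assert (o2 : u ^ 2 <= (2 * PI * u) ^ 2).
    { replace ((2 * PI * u) ^ 2) with ((2 * PI) ^ 2 * u ^ 2) by ring.
      rewrite <- (Rmult_1_l (u ^ 2)) at 1. apply Rmult_le_compat_r; [lra|].
      apply pow_R1_Rle. lra. }
    unfold Rdiv at 1. rewrite Rabs_mult, Rabs_inv, (Rabs_pos_eq ((2 * PI * u) ^ 2)) by lra.
    assert (B : Rabs (2 * (cos (2 * PI * u) - cos (2 * (2 * PI * u)))) <= 4).
    { assert (b1 := COS_bound (2 * PI * u)). assert (b2 := COS_bound (2 * (2 * PI * u))).
      apply Rabs_le. lra. }
    apply Rle_trans with (4 * / u ^ 2).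
    * apply Rmult_le_compat; auto using Rabs_pos.
      -- left; apply Rinv_0_lt_compat; lra.
      -- apply Rinv_le_contravar; lra.
    * apply (Rle_div_r (4 * / u ^ 2)); auto.
      replace (4 * / u ^ 2 * (u ^ 2 + 1 ^ 2)) with (4 + 4 * / u ^ 2) by (field; lra).
      assert (/ u ^ 2 <= / 1) by (apply Rinv_le_contravar; lra). lra.
Qed.

(** The trapezoid takes the inversion weight 2 on [0, 1], and on (1, 2] the transform of [f] is
    0. *)
Lemma band_limited_reproducing (f : R -> R) (x : R) : abs_integrable f -> band_limited f ->
  conv reproducing_kernel f x = f x.
Proof.
intros Hf Hb.
rewrite (conv_comm _ _ _ (2 * norm1 f)); auto using reproducing_kernel_abs_integrable.
2:{ apply Hf. }
2:{ intros; now apply band_limited_bound. }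
destruct (conv_cosine_kernel f trapezoid 0 2 2 x) as [CI E];
  auto using trapezoid_continuity, trapezoid_bound; [lra|].
unfold reproducing_kernel. rewrite E, <- (RInt_Chasles_R _ 0 1 2) by auto.
rewrite (RInt_ext_R _ (fun xi => 2 * cosine_conv f x xi) 0 1); [|lra|].
2:{ intros xi Hxi. unfold trapezoid. rewrite (Rabs_pos_eq (2 - xi)), Rmin_left by lra. ring. }
rewrite (RInt_ext_R (fun xi => trapezoid xi * cosine_conv f x xi) (fun _ => 0) 1 2); [|lra|].
2:{ intros xi Hxi. rewrite Hb by lra. ring. }
rewrite RInt_const_R, RInt_scal_R by now apply cosine_conv_continuity.
rewrite (band_limited_inversion f x Hf Hb). ring.
Qed.

(** * Vanishing integral, injectivity and sign changes *)

(** On [-M, M] the multiplier is at most M/a, and outside it the tail of [g] is small. The threshold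
    [A] is uniform over multipliers, so that [m] may itself depend on [a]. *)
Lemma Int_mult_vanishing (g : R -> R) (eps : R) : abs_integrable g -> 0 < eps ->
  exists A, 0 < A /\ forall a (m : R -> R), A <= a -> continuity m ->
    (forall u, Rabs (m u) <= 1) -> (forall u, Rabs (m u) <= Rabs u / a) ->
    Rabs (Int (fun u => g u * m u)) <= eps.
Proof.
intros Hg He. assert (Ha := abs_integrable_abs g Hg). assert (g0 := norm1_nonneg g Hg).
destruct (Int_tail_small _ (eps / 2) Ha) as [M [HM HT]]; [lra|].
specialize (HT (- M) M (Rle_refl _) (Rle_refl _)).
set (B := M * norm1 g). assert (B0 : 0 <= B) by now apply Rmult_le_pos.
destruct (exists_large_quotient B (eps / 2)) as [A [HA Q]]; auto; [lra|].
exists A. split; [lra|]. intros a m Haa Cm H1 Ha2.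
assert (Cgm : continuity (fun u => g u * m u)) by (apply continuity_mult_fun; auto; apply Hg).
assert (T := Int_tail_dom (fun u => g u * m u) (fun u => Rabs (g u)) (- M) M Cgm Ha).
assert (T' : Rabs (Int (fun u => g u * m u) - RInt (fun u => g u * m u) (- M) M) <= eps / 2).
{ eapply Rle_trans; [apply T|exact HT]; [|lra].
  intros u. rewrite Rabs_mult. rewrite <- (Rmult_1_r (Rabs (g u))) at 2. apply Rmult_le_compat_l; auto using Rabs_pos. }
assert (S : Rabs (RInt (fun u => g u * m u) (- M) M) <= eps / 2).
{ apply Rle_trans with (RInt (fun u => M / a * Rabs (g u)) (- M) M).
  - apply abs_RInt_le_R; auto; [apply continuity_scal_fun, Ha|lra|].
    intros u Hu. rewrite Rabs_mult, Rmult_comm. apply Rmult_le_compat_r; auto using Rabs_pos.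
    eapply Rle_trans; [apply Ha2|]. apply Rmult_le_compat_r.
    + left; apply Rinv_0_lt_compat; lra.
    + apply Rabs_le. lra.
  - rewrite RInt_scal_R by apply Ha.
    apply Rle_trans with (M / a * norm1 g).
    + apply Rmult_le_compat_l; [apply Rdiv_le_0_compat; lra|].
      apply RInt_le_Int; auto using Rabs_pos. lra.
    + eapply Rle_trans; [|apply Q].
      replace (M / a * norm1 g) with (B * / a) by (unfold B, Rdiv; ring).
      apply Rmult_le_compat_l; auto. apply Rinv_le_contravar; lra. }
replace (Int (fun u => g u * m u)) with
  ((Int (fun u => g u * m u) - RInt (fun u => g u * m u) (- M) M) +
   RInt (fun u => g u * m u) (- M) M) by ring.
eapply Rle_trans; [apply Rabs_triang|]. lra.
Qed.

(* As [a] tends to infinity, [a * poisson a] tends to 1 and [a * conj_poisson a] to 0. *)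
Lemma conjugate_integral_zero (f h : R -> R) : abs_integrable f -> abs_integrable h ->
  (forall a, 0 < a -> conv (poisson a) h 0 = conv f (conj_poisson a) 0) -> Int h = 0.
Proof.
intros Hf Hh E. apply cond_eq. intros eps He. rewrite Rminus_0_r.
(* A convolution evaluated at 0 sees the reflected function u -> h(-u), which has the same
   integral. *)
assert (Hr := abs_integrable_reflect h 0 Hh).
destruct (Int_mult_vanishing _ (eps / 3) Hr) as [A1 [HA1 H1]]; [lra|].
destruct (Int_mult_vanishing f (eps / 3) Hf) as [A2 [HA2 H2]]; [lra|].
set (a := Rmax A1 A2). assert (h1 := Rmax_l A1 A2). assert (h2 := Rmax_r A1 A2). fold a in h1, h2.
assert (Ha : 0 < a) by lra.
specialize (H1 a (fun u => 1 - a * poisson a u) h1).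
specialize (H2 a (fun u => a * conj_poisson a (0 - u)) h2).
assert (CP := poisson_continuity a Ha). assert (CQ := conj_poisson_continuity a Ha).
assert (IP := abs_integrable_mult_bounded _ (poisson a) (/ a) Hr CP (fun u => poisson_bound a u Ha)).
assert (B1 : Rabs (Int (fun u => h (0 - u) * (1 - a * poisson a u))) <= eps / 3).
{ apply H1.
  - apply (continuity_minus_fun (fun _ => 1)); [reg|]. now apply continuity_scal_fun.
  - intros u. assert (p1 := poisson_pos a u Ha). assert (p2 := poisson_le_inv a u Ha).
    assert (a * poisson a u <= a * / a) by (apply Rmult_le_compat_l; lra).
    rewrite Rinv_r in H by lra. assert (0 < a * poisson a u) by now apply Rmult_lt_0_compat.
    apply Rabs_le. lra.
  (* Here 1 - a P_a(u) = u^2 / (u^2 + a^2), and a|u| <= u^2 + a^2. *)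
  - intros u. assert (hs := sum_sqr_pos a u Ha).
    replace (1 - a * poisson a u) with (u ^ 2 / (u ^ 2 + a ^ 2)) by (unfold poisson; field; lra).
    assert (hu := Rabs_pos u). rewrite <- (pow2_abs u) in *.
    rewrite Rabs_pos_eq by (apply Rdiv_le_0_compat; nra).
    apply (Rle_div_l (Rabs u ^ 2)); auto.
    apply (Rmult_le_reg_l a); auto.
    replace (a * (Rabs u / a * (Rabs u ^ 2 + a ^ 2))) with (Rabs u * (Rabs u ^ 2 + a ^ 2))
      by (field; lra).
    replace (a * Rabs u ^ 2) with (Rabs u * (a * Rabs u)) by ring.
    apply Rmult_le_compat_l; auto. nra. }
assert (B2 : Rabs (Int (fun u => f u * (a * conj_poisson a (0 - u)))) <= eps / 3).
{ apply H2.
  - apply (continuity_scal_fun a (fun u => conj_poisson a (0 - u))). now apply continuity_reflect.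
  - intros u. rewrite Rabs_mult, (Rabs_pos_eq a) by lra.
    rewrite <- (Rinv_r a) by lra. apply Rmult_le_compat_l; [lra|]. now apply conj_poisson_bound.
  - intros u. assert (hs := sum_sqr_pos a u Ha). assert (hu := Rabs_pos u).
    rewrite Rabs_mult, (Rabs_pos_eq a) by lra. unfold conj_poisson, Rdiv.
    replace ((0 - u) ^ 2) with (u ^ 2) by ring.
    rewrite Rabs_mult, Rabs_inv, (Rabs_pos_eq (u ^ 2 + a ^ 2)) by lra.
    replace (0 - u) with (- u) by ring. rewrite Rabs_Ropp.
    replace (a * (Rabs u * / (u ^ 2 + a ^ 2))) with (Rabs u * (a * / (u ^ 2 + a ^ 2))) by ring.
    apply Rmult_le_compat_l; auto.
    apply (Rle_div_l a); auto. apply (Rmult_le_reg_l a); auto.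
    replace (a * (/ a * (u ^ 2 + a ^ 2))) with (u ^ 2 + a ^ 2) by (field; lra). nra. }
assert (E1 : Int (fun u => h (0 - u) * (1 - a * poisson a u)) = Int h - a * conv (poisson a) h 0).
{ rewrite (Int_ext _ (fun u => h (0 - u) - a * (h (0 - u) * poisson a u))) by (intros; ring).
  rewrite Int_minus, Int_scal, (Int_reflect h) by auto using abs_integrable_scal.
  unfold conv. do 2 f_equal. apply Int_ext. intros; ring. }
assert (E2 : Int (fun u => f u * (a * conj_poisson a (0 - u))) = a * conv f (conj_poisson a) 0).
{ unfold conv. rewrite <- Int_scal; [apply Int_ext; intros; ring|].
  apply (abs_integrable_conv f (conj_poisson a) 0 (/ a)); auto.
  intros; now apply conj_poisson_bound. }
rewrite E1, E in B1 by auto. rewrite E2 in B2.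
apply Rabs_le_between in B1. apply Rabs_le_between in B2. apply Rabs_lt_between. lra.
Qed.

(* By the Cauchy-Riemann equations, d/dv of [poisson a v] is d/da of [conj_poisson a v]. *)
Lemma poisson_Cauchy_Riemann (a : R) : 0 < a -> exists C, 0 <= C /\
  forall v d, Rabs d <= a / 2 ->
  Rabs (poisson a (v + d) - poisson a v - (conj_poisson (a + d) v - conj_poisson a v)) <= C * d ^ 2.
Proof.
(* The three terms of [T] below contribute 32, 1 and 4, rounded up to 40. *)
intros Ha. exists (40 / a ^ 3). assert (a3 : 0 < a ^ 3) by (apply pow_lt; lra).
split. { apply Rdiv_le_0_compat; lra. }
intros v d Hd. apply Rabs_le_between in Hd.
assert (a2 : 0 < a ^ 2) by nra.
set (Z := v ^ 2 + a ^ 2). set (X := (v + d) ^ 2 + a ^ 2). set (Y := v ^ 2 + (a + d) ^ 2).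
assert (hZ : a ^ 2 <= Z) by (unfold Z; assert (h := pow2_ge_0 v); lra).
assert (hX : a ^ 2 <= X) by (unfold X; assert (h := pow2_ge_0 (v + d)); lra).
assert (hY : a ^ 2 / 4 <= Y) by (unfold Y; assert (h := pow2_ge_0 v); nra).
(* The terms of first order in [d] cancel, so the difference is exactly divisible by d^2, with
   quotient [- T]. The condition |d| <= a/2 keeps [Y] at least a^2/4. *)
set (T := 4 * a * v * (a - v) / (Z * X * Y) + a / (Z * X) - v / (Z * Y)).
replace (_ - _ - _) with (- T * d ^ 2).
2:{ unfold T, poisson, conj_poisson. fold Z X Y. unfold Rdiv.
  apply (Rmult_eq_reg_r (Z * X * Y)); [|apply Rgt_not_eq; repeat apply Rmult_lt_0_compat; lra].
  field_simplify; try lra. unfold X, Y, Z. ring. }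
rewrite Rabs_mult, Rabs_Ropp, (Rabs_pos_eq (d ^ 2)) by apply pow2_ge_0.
apply Rmult_le_compat_r; [apply pow2_ge_0|].
assert (iX : 0 < / X <= / a ^ 2) by (split; [apply Rinv_0_lt_compat|apply Rinv_le_contravar]; lra).
assert (iY : 0 < / Y <= 4 * / a ^ 2).
{ split; [apply Rinv_0_lt_compat; lra|].
  replace (4 * / a ^ 2) with (/ (a ^ 2 / 4)) by (field; lra). apply Rinv_le_contravar; lra. }
assert (iZ : 0 < / Z <= / a ^ 2) by (split; [apply Rinv_0_lt_compat|apply Rinv_le_contravar]; lra).
assert (vZ : Rabs (v / Z) <= / a).
{ assert (h := conj_poisson_bound a v Ha). exact h. }
assert (wZ : Rabs (v * (a - v) / Z) <= 2).
{ unfold Rdiv. rewrite Rabs_mult, (Rabs_pos_eq (/ Z)) by lra.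
  apply (Rle_div_l (Rabs (v * (a - v))) 2 Z); [lra|].
  apply Rabs_le. unfold Z. split; nra. }
assert (b1 : Rabs (4 * a * v * (a - v) / (Z * X * Y)) <= 32 / a ^ 3).
{ replace (4 * a * v * (a - v) / (Z * X * Y)) with (4 * a * (v * (a - v) / Z) * (/ X * / Y))
    by (field; lra).
  replace (32 / a ^ 3) with (4 * a * 2 * (/ a ^ 2 * (4 * / a ^ 2))) by (field; lra).
  rewrite !Rabs_mult, (Rabs_pos_eq 4), (Rabs_pos_eq a), (Rabs_pos_eq (/ X)), (Rabs_pos_eq (/ Y)) by lra.
  apply Rmult_le_compat.
  - apply Rmult_le_pos; [lra|apply Rabs_pos].
  - apply Rmult_le_pos; lra.
  - apply Rmult_le_compat_l; lra.
  - apply Rmult_le_compat; lra. }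
assert (b2 : Rabs (a / (Z * X)) <= 1 / a ^ 3).
{ replace (a / (Z * X)) with (a * (/ Z * / X)) by (field; lra).
  replace (1 / a ^ 3) with (a * (/ a ^ 2 * / a ^ 2)) by (field; lra).
  rewrite Rabs_pos_eq by (repeat apply Rmult_le_pos; lra).
  apply Rmult_le_compat_l; [lra|]. apply Rmult_le_compat; lra. }
assert (b3 : Rabs (v / (Z * Y)) <= 4 / a ^ 3).
{ replace (v / (Z * Y)) with (v / Z * / Y) by (field; lra).
  replace (4 / a ^ 3) with (/ a * (4 * / a ^ 2)) by (field; lra).
  rewrite Rabs_mult, (Rabs_pos_eq (/ Y)) by lra.
  apply Rmult_le_compat; auto using Rabs_pos; lra. }
replace (40 / a ^ 3) with (32 / a ^ 3 + 1 / a ^ 3 + 7 / a ^ 3) by (field; lra).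
assert (0 <= 3 / a ^ 3) by (apply Rdiv_le_0_compat; lra).
replace (7 / a ^ 3) with (4 / a ^ 3 + 3 / a ^ 3) by (field; lra).
apply Rabs_le_between in b1. apply Rabs_le_between in b2. apply Rabs_le_between in b3.
unfold T. apply Rabs_le. lra.
Qed.

(** Such a function has derivative 0 everywhere. Working with increments avoids differentiating a
    convolution under the integral sign. *)
Lemma constant_of_quadratic_increments (D : R -> R) (C r : R) : 0 <= C -> 0 < r ->
  (forall z d, Rabs d <= r -> Rabs (D (z + d) - D z) <= C * d ^ 2) -> forall x y, D x = D y.
Proof.
intros HC Hr H.
assert (HD : forall z, is_derive D z 0).
{ intros z. apply is_derive_Reals. intros eps He.
  assert (Hd : 0 < Rmin r (eps / (C + 1))) by (apply Rmin_glb_lt; auto; apply Rdiv_lt_0_compat; lra).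
  exists (mkposreal _ Hd). simpl. intros d Hd0 Hdl.
  assert (h1 := Rmin_l r (eps / (C + 1))). assert (h2 := Rmin_r r (eps / (C + 1))).
  assert (dp := Rabs_pos_lt d Hd0).
  rewrite Rminus_0_r. unfold Rdiv. rewrite Rabs_mult, Rabs_inv.
  apply Rle_lt_trans with (C * Rabs d).
  - apply (Rle_div_l (Rabs (D (z + d) - D z)) (C * Rabs d)); auto.
    replace (C * Rabs d * Rabs d) with (C * d ^ 2) by (rewrite <- (pow2_abs d); ring).
    apply H. lra.
  - apply Rle_lt_trans with ((C + 1 / 2) * Rabs d); [nra|].
    apply Rlt_le_trans with ((C + 1) * Rabs d); [nra|].
    apply Rle_trans with ((C + 1) * (eps / (C + 1))).
    + apply Rmult_le_compat_l; lra.
    + right; field; lra. }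
assert (W : forall x y, x < y -> D x = D y).
{ intros x y Hxy. now apply (eq_is_derive D). }
intros x y. destruct (Rtotal_order x y) as [h|[->|h]]; auto. symmetry; auto.
Qed.

Lemma abs_integrable_constant (f : R -> R) : abs_integrable f -> (forall x y, f x = f y) ->
  forall x, f x = 0.
Proof.
intros [Cf [B HB]] Hc x. apply cond_eq. intros eps He. rewrite Rminus_0_r.
assert (hB := Rabs_pos B).
set (b := (Rabs B + 1) / eps). assert (b0 : 0 < b) by (apply Rdiv_lt_0_compat; lra).
specialize (HB 0 b ltac:(lra)).
rewrite (RInt_ext _ (fun _ => Rabs (f x))) in HB by (intros y _; now rewrite (Hc y x)).
rewrite RInt_const_R in HB. assert (h := Rle_abs B).
apply (Rmult_lt_reg_l b); auto. replace (b * eps) with (Rabs B + 1) by (unfold b; field; lra).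
lra.
Qed.

Lemma hilbert_injective (f : R -> R) : abs_integrable f ->
  (forall a x, 0 < a -> conv f (conj_poisson a) x = 0) -> forall x, f x = 0.
Proof.
intros Hf HQ. apply abs_integrable_constant; auto.
assert (f0 := norm1_nonneg f Hf). assert (hp := PI2_1).
assert (K : forall a x y, 0 < a -> conv f (poisson a) x = conv f (poisson a) y).
{ intros a x y Ha. destruct (poisson_Cauchy_Riemann a Ha) as [C [HC H]].
  apply (constant_of_quadratic_increments (conv f (poisson a)) (C * norm1 f) (a / 2));
    [now apply Rmult_le_pos|lra|].
  intros z d Hd.
  assert (had : 0 < a + d) by (apply Rabs_le_between in Hd; lra).
  assert (IP : forall z, abs_integrable (fun u => f u * poisson a (z - u))).
  { intros w. apply abs_integrable_conv with (/ a); auto using poisson_continuity.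
    intros; now apply poisson_bound. }
  assert (IQ : forall b, 0 < b -> abs_integrable (fun u => f u * conj_poisson b (z - u))).
  { intros b Hb. apply abs_integrable_conv with (/ b); auto using conj_poisson_continuity.
    intros; now apply conj_poisson_bound. }
  (* The conjugate convolutions at heights a + d and a are both 0, so they may be subtracted; the
     Cauchy-Riemann estimate, integrated against |f|, then bounds the increment by C ||f||_1 d^2. *)
  replace (conv f (poisson a) (z + d) - conv f (poisson a) z) with
    (conv f (poisson a) (z + d) - conv f (poisson a) z -
     (conv f (conj_poisson (a + d)) z - conv f (conj_poisson a) z)) by (rewrite !HQ by auto; ring).
  unfold conv. rewrite <- !Int_minus by auto using abs_integrable_minus.
  replace (C * norm1 f * d ^ 2) with (C * d ^ 2 * norm1 f) by ring.
  unfold norm1. rewrite <- Int_scal by now apply abs_integrable_abs.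
  apply Int_abs_le.
  - apply (abs_integrable_minus _ _ (abs_integrable_minus _ _ (IP (z + d)) (IP z))
      (abs_integrable_minus _ _ (IQ (a + d) had) (IQ a Ha))).
  - now apply abs_integrable_scal, abs_integrable_abs.
  - intros u. specialize (H (z - u) d Hd).
    replace (z - u + d) with (z + d - u) in H by ring.
    rewrite <- !Rmult_minus_distr_l, Rabs_mult, Rmult_comm.
    apply Rmult_le_compat_r; auto using Rabs_pos. }
intros x y. apply cond_eq. intros eps He.
destruct (poisson_approximation f x (eps / 3)) as [a1 [Ha1 H1]]; auto; [lra|].
destruct (poisson_approximation f y (eps / 3)) as [a2 [Ha2 H2]]; auto; [lra|].
assert (Ha : 0 < Rmin a1 a2) by now apply Rmin_glb_lt.
specialize (H1 _ Ha (Rmin_l _ _)). specialize (H2 _ Ha (Rmin_r _ _)).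
rewrite (K _ x y Ha) in H1.
apply Rabs_le_between in H1. apply Rabs_le_between in H2.
apply Rabs_lt_between. split; apply (Rmult_lt_reg_l PI); nra.
Qed.

Lemma norm1_pos (g : R -> R) (x : R) : abs_integrable g -> g x <> 0 -> 0 < norm1 g.
Proof.
intros Hg Hx. assert (px := Rabs_pos_lt _ Hx).
assert (Ca := continuity_abs_fun g (proj1 Hg)).
destruct (continuity_pt_lt _ x (Rabs (g x) / 2) (Ca x)) as [d [Hd H]]; [lra|].
apply Rlt_le_trans with (RInt (fun _ => Rabs (g x) / 2) (x - d / 2) (x + d / 2)).
- rewrite RInt_const_R. nra.
- apply Rle_trans with (RInt (fun y => Rabs (g y)) (x - d / 2) (x + d / 2)).
  + apply RInt_le_R; auto; [reg|lra|]. intros y Hy.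
    specialize (H y). assert (Rabs (y - x) < d) by (apply Rabs_lt_between; lra).
    specialize (H H0). apply Rabs_lt_between in H. lra.
  + apply RInt_le_Int; auto using abs_integrable_abs, Rabs_pos. lra.
Qed.

Lemma sign_change_radius (g : R -> R) (K r s : R) : abs_integrable g -> (exists x, g x <> 0) ->
  s = 1 \/ s = -1 -> 0 < r -> (forall x, Rabs (g x) <= K * norm1 g) -> Int g = 0 ->
  (forall x, r <= Rabs x -> 0 <= s * g x) -> 1 <= 4 * r * K.
Proof.
intros Hg [x0 Hx0] Hs Hr HK H0 Hsign.
assert (n0 := norm1_pos g x0 Hg Hx0).
(* Twice the negative part of [s * g]: it lives on [-r, r], has integral ||g||_1 because [g] has
   integral 0, and is at most 2K ||g||_1. *)
set (phi := fun x => Rabs (g x) - s * g x).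
assert (Hphi : abs_integrable phi).
{ apply abs_integrable_minus; auto using abs_integrable_abs, abs_integrable_scal. }
assert (E : Int phi = norm1 g).
{ unfold phi. rewrite Int_minus, Int_scal, H0 by auto using abs_integrable_abs, abs_integrable_scal.
  unfold norm1. ring. }
assert (Z : forall x, r <= Rabs x -> phi x = 0).
{ intros x Hx. specialize (Hsign x Hx). unfold phi.
  destruct Hs as [-> | ->]; [rewrite Rabs_pos_eq|rewrite Rabs_left1]; lra. }
assert (Zint : forall a b, a <= b -> (forall x, a < x < b -> r <= Rabs x) -> RInt phi a b = 0).
{ intros a b Hab H. rewrite (RInt_ext_R phi (fun _ => 0)); auto.
  now rewrite RInt_const_R, Rmult_0_r. }
assert (B : norm1 g <= 2 * r * (2 * (K * norm1 g))).
{ rewrite <- E at 1. apply (is_int_limit_le phi _ _ (- r) r (abs_integrable_is_int _ Hphi)).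
  intros a b Ha Hb.
  rewrite <- (RInt_Chasles_R phi a (- r) b), <- (RInt_Chasles_R phi (- r) r b) by apply Hphi.
  rewrite (Zint a (- r)), (Zint r b), Rplus_0_l, Rplus_0_r; auto.
  - eapply Rle_trans; [apply Rle_abs|].
    replace (2 * r) with (r - - r) by ring.
    apply abs_RInt_le_const; [lra|apply continuity_ex_RInt, Hphi|].
    intros t _. unfold phi. specialize (HK t).
    unfold Rminus. eapply Rle_trans; [apply Rabs_triang|].
    rewrite Rabs_Ropp, Rabs_Rabsolu, Rabs_mult.
    replace (Rabs s) with 1; [lra|].
    destruct Hs as [-> | ->]; [rewrite Rabs_pos_eq|rewrite Rabs_left1]; lra.
  - intros x Hx. rewrite Rabs_pos_eq; lra.
  - intros x Hx. rewrite Rabs_left1; lra. }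
apply (Rmult_le_reg_r (norm1 g)); auto. lra.
Qed.

(** * Translation of the hypotheses of the theorem, and the two radius bounds *)

Lemma integral_eq_RInt (g : R -> R) (a b v : R) : integral_eq g a b v -> RInt g a b = v.
Proof. intros [pr <-]. apply RInt_Reals. Qed.

Lemma is_L1_abs_integrable (g : R -> R) : continuity g -> is_L1 g -> abs_integrable g.
Proof.
intros Cg [_ [B HB]]. split; auto. exists B. intros a b Hab.
destruct (HB a b Hab) as [w [Hw Hle]]. now rewrite (integral_eq_RInt _ _ _ _ Hw).
Qed.

Lemma improper_int_Int (g : R -> R) (v : R) : improper_int g v -> Int g = v.
Proof.
intros H. apply is_int_Int. intros eps He. destruct (H eps He) as [M HM].
assert (h1 := Rmax_l M 0). assert (h2 := Rmax_r M 0).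
exists (Rmax M 0). split; auto. intros a b Ha Hb.
destruct (HM a b) as [w [Hw Hlt]]; [lra..|].
rewrite (integral_eq_RInt _ _ _ _ Hw). lra.
Qed.

(** Specialize the inner and outer cutoffs to 1/N and N, and reflect the half over negative [t] onto
    the positive one. *)
Lemma hilbert_pv_is_hilbert (f h : R -> R) : continuity f ->
  (forall x, hilbert_pv f x (h x)) -> is_hilbert f h.
Proof.
intros Cf H x eps He. assert (hp := PI2_1).
destruct (H x eps He) as [delta [M [Hd HM]]].
assert (h1 := Rmax_l 1 (Rmax (2 / delta) (M + 1))). assert (h2 := Rmax_r 1 (Rmax (2 / delta) (M + 1))).
assert (h3 := Rmax_l (2 / delta) (M + 1)). assert (h4 := Rmax_r (2 / delta) (M + 1)).
(* The entries 2/delta and M + 1 turn weak bounds on [N] into the strict ones 1/N < delta and M <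
   N. *)
exists (Rmax 1 (Rmax (2 / delta) (M + 1))). intros N HN.
assert (HN1 : 1 <= N) by lra. destruct (inv_le_self N HN1) as [n1 n2].
assert (small : / N < delta).
{ apply Rle_lt_trans with (/ (2 / delta)).
  - apply Rinv_le_contravar; [apply Rdiv_lt_0_compat; lra|lra].
  - replace (/ (2 / delta)) with (delta / 2) by (field; lra). lra. }
destruct (HM (/ N) N) as [w1 [w2 [E1 [E2 Hlt]]]]; [lra..|].
apply integral_eq_RInt in E1. apply integral_eq_RInt in E2.
assert (W := weight_continuity N HN1).
assert (C2 : continuity (fun t => weight N t * f (x - t))).
{ apply continuity_mult_fun; auto using continuity_reflect. }
assert (C1 : continuity (fun t => weight N t * f (x + t))).
{ apply continuity_mult_fun; auto using continuity_translate. }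
assert (F2 : RInt (fun t => weight N t * f (x - t)) (/ N) N = w2).
{ rewrite <- E2. apply RInt_ext_R; auto. intros t Ht. rewrite weight_eq by lra. unfold Rdiv. ring. }
assert (F1 : w1 = -1 * RInt (fun t => weight N t * f (x + t)) (/ N) N).
{ rewrite <- E1.
  rewrite (RInt_ext_R (fun t => f (x - t) / t)
    (fun t => -1 * (fun u => weight N u * f (x + u)) (0 - t)) (- N) (- / N)).
  - rewrite RInt_scal_R by (apply (continuity_reflect (fun u => weight N u * f (x + u))); auto).
    rewrite (RInt_reflect (fun u => weight N u * f (x + u))) by auto.
    replace (0 - - / N) with (/ N) by ring. now replace (0 - - N) with N by ring.
  - lra.
  - intros t Ht. rewrite weight_eq by lra. replace (x + (0 - t)) with (x - t) by ring.
    field. lra. }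
unfold truncated_hilbert.
rewrite (RInt_ext_R _ (fun t => weight N t * f (x - t) - weight N t * f (x + t)))
  by (auto; intros; ring).
rewrite RInt_minus_R, F2 by auto. rewrite F1 in Hlt.
match type of Hlt with Rabs (?u - _) < _ => match goal with |- Rabs (?v - _) <= _ =>
  replace v with u by (unfold Rdiv; ring) end end. lra.
Qed.

(** The addition formula writes cos(2 pi (x - y) xi) in terms of the cosine and sine transforms,
    both 0 beyond frequency 1. *)
Lemma PW1_band_limited (f : R -> R) : PW1 f -> abs_integrable f /\ band_limited f.
Proof.
intros [Cf [L1 H]]. assert (Hf := is_L1_abs_integrable f Cf L1). split; auto.
intros x xi Hxi. destruct (H xi) as [Hc Hs]; [rewrite Rabs_pos_eq; lra|].
apply improper_int_Int in Hc. apply improper_int_Int in Hs.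
assert (Ic : abs_integrable (fun y => f y * cos (2 * PI * y * xi))).
{ apply abs_integrable_mult_bounded with 1; auto using cosine_continuity, Rabs_cos_le_1. }
assert (Is : abs_integrable (fun y => f y * sin (2 * PI * y * xi))).
{ apply abs_integrable_mult_bounded with 1; auto.
  - reg.
  - intros; apply Rabs_le, SIN_bound. }
unfold cosine_conv, conv.
rewrite (Int_ext _ (fun y => cos (2 * PI * x * xi) * (f y * cos (2 * PI * y * xi)) +
  sin (2 * PI * x * xi) * (f y * sin (2 * PI * y * xi)))).
- rewrite Int_plus, !Int_scal, Hc, Hs by auto using abs_integrable_scal. ring.
- intros y. replace (2 * PI * (x - y) * xi) with (2 * PI * x * xi - 2 * PI * y * xi) by ring.
  rewrite cos_minus. ring.
Qed.

Lemma sign_change_radius_f (f : R -> R) (r : R) : PW1 f -> (exists x, f x <> 0) ->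
  fourier_cos_eq f 0 0 -> 0 < r -> (forall y, r <= Rabs y -> 0 <= f y) -> / 8 <= r.
Proof.
intros Hf Hnz H0 Hr Hsign. destruct (PW1_band_limited f Hf) as [If Hb].
assert (1 <= 4 * r * 2); [|lra].
apply (sign_change_radius f 2 r 1); auto.
- intros; now apply band_limited_bound.
- rewrite <- (improper_int_Int _ _ H0). apply Int_ext. intros x.
  rewrite Rmult_0_r, cos_0. ring.
- intros x Hx. rewrite Rmult_1_l. auto.
Qed.

Lemma sign_change_radius_h (f h : R -> R) (r s : R) : PW1 f -> (exists x, f x <> 0) ->
  (forall x, hilbert_pv f x (h x)) -> is_L1 h -> s = 1 \/ s = -1 ->
  0 < r -> (forall x, r <= Rabs x -> 0 <= s * h x) -> / 16 <= r.
Proof.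
intros Hf Hnz Hh L1h Hs Hr Hsign. destruct (PW1_band_limited f Hf) as [If Hb].
assert (HL := band_limited_Lipschitz f If Hb).
assert (HH := hilbert_pv_is_hilbert f h (proj1 If) Hh).
assert (Bf : exists K, forall y, Rabs (f y) <= K).
{ exists (2 * norm1 f). intros; now apply band_limited_bound. }
assert (Ih := is_L1_abs_integrable h (hilbert_continuity f h _ If HL HH) L1h).
assert (T : forall a x, 0 < a -> conv (poisson a) h x = conv f (conj_poisson a) x).
{ intros a x Ha.
  apply (conv_hilbert_transfer (poisson a) (conj_poisson a) f h (4 * PI * norm1 f) (/ a ^ 2));
    auto using poisson_abs_integrable, poisson_Lipschitz, is_hilbert_poisson.
  - exists (/ a). intros; now apply poisson_bound.
  - exists (/ a). intros; now apply conj_poisson_bound. }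
assert (1 <= 4 * r * 4); [|lra].
apply (sign_change_radius h 4 r s); auto.
- destruct (Classical_Prop.classic (exists x, h x <> 0)) as [|Hz]; auto. exfalso.
  assert (h0 : forall x, h x = 0).
  { intros x. destruct (Req_dec (h x) 0); auto. exfalso. eauto. }
  destruct Hnz as [x Hx]. apply Hx. apply hilbert_injective; auto.
  (* If [h] is 0, so is its Poisson integral, and by [T] the conjugate Poisson integral of [f] at
     every height. *)
  intros a y Ha. rewrite <- T by auto. unfold conv.
  rewrite (Int_ext _ (fun u => 0 * poisson a u)).
  + rewrite Int_scal by now apply poisson_abs_integrable. ring.
  + intros u. rewrite h0. ring.
- intros x. rewrite <- (conv_hilbert_fixed reproducing_kernel f h _ x
    reproducing_kernel_abs_integrable If HL HH Bf) by (intros; now apply band_limited_reproducing).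
  (* Commuting makes [h] the integrable factor, so the bound is 4 ||h||_1, with no norm of the
     kernel involved. *)
  rewrite <- (conv_comm h reproducing_kernel x 4) by
    auto using reproducing_kernel_continuity, reproducing_kernel_bound.
  apply conv_abs_le; auto using reproducing_kernel_continuity, reproducing_kernel_bound.
- apply (conjugate_integral_zero f h); auto.
Qed.

(** * Constants and exponents *)

Lemma Cp_ge_1 (p : R) : 1 < p -> 1 <= Cp p.
Proof.
intros Hp. assert (hp := PI2_1). unfold Cp.
assert (E : PI / (2 * p) = PI / 2 * / p) by (field; lra).
assert (ip : 0 < / p < 1).
{ split; [apply Rinv_0_lt_compat; lra|]. rewrite <- Rinv_1. apply Rinv_lt_contravar; lra. }
destruct (Rle_dec p 2) as [H|H].
- assert (i2 : / 2 <= / p) by (apply Rinv_le_contravar; lra).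
  rewrite <- tan_PI4. destruct (Req_dec (PI / (2 * p)) (PI / 4)) as [->|Hne]; [lra|].
  left. apply tan_increasing; rewrite ?E in *; nra.
- assert (i2 : / p < / 2) by (apply Rinv_lt_contravar; lra).
  assert (t0 : 0 < tan (PI / (2 * p))) by (apply tan_gt_0; rewrite E; nra).
  assert (t1 : tan (PI / (2 * p)) < 1).
  { rewrite <- tan_PI4. apply tan_increasing; rewrite ?E; nra. }
  unfold Rdiv. rewrite Rmult_1_l, <- Rinv_1. apply Rinv_le_contravar; lra.
Qed.

Lemma Rpower_2_neg (n : nat) : Rpower 2 (- INR n) = / 2 ^ n.
Proof. rewrite Rpower_Ropp, Rpower_pow; auto. lra. Qed.

Theorem mainTheorem19 (s p : R) (f h : R -> R) (r1 r2 : R) :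
  (s = 1 \/ s = -1) ->
  1 < p ->
  PW1 f ->
  (exists x, f x <> 0) ->
  fourier_cos_eq f 0 0 ->
  (forall x, hilbert_pv f x (h x)) ->
  is_L1 h ->
  0 < r1 -> 0 < r2 ->
  (forall y, r1 <= Rabs y -> 0 <= f y) ->
  (forall x, r2 <= Rabs x -> 0 <= s * h x) ->
  Rpower r1 (1 / conj_exp p) * Rpower r2 (1 / p)
    >= Rpower 2 (- (conj_exp p + 2)) * Rpower (Cp p) (- ((p + 1) / (p - 1))).
Proof.
intros Hs Hp Hf Hnz H0 Hh L1h Hr1 Hr2 Hsf Hsh. apply Rle_ge.
assert (R1 := sign_change_radius_f f r1 Hf Hnz H0 Hr1 Hsf).
assert (R2 := sign_change_radius_h f h r2 s Hf Hnz Hh L1h Hs Hr2 Hsh).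
assert (C1 := Cp_ge_1 p Hp).
assert (e8 : / 8 = Rpower 2 (- INR 3)) by (rewrite Rpower_2_neg; lra).
assert (e16 : / 16 = Rpower 2 (- INR 4)) by (rewrite Rpower_2_neg; lra).
assert (ip : 0 < / p) by (apply Rinv_0_lt_compat; lra).
assert (ip1 : / p <= / (p - 1)) by (apply Rinv_le_contravar; lra).
assert (iq : 1 / conj_exp p = 1 - / p) by (unfold conj_exp; field; lra).
assert (eq : conj_exp p = 1 + / (p - 1)) by (unfold conj_exp; field; lra).
assert (ip2 : / p < 1) by (rewrite <- Rinv_1; apply Rinv_lt_contravar; lra).
rewrite iq, eq. replace (1 / p) with (/ p) by (field; lra).
(* The middle term is 2^-(3 + 1/p), the product of the two radius bounds. The target exponent is 3 +
   1/(p - 1), at least as large, and the factor with [Cp p] is at most 1 since its exponent is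
   negative. *)
apply Rle_trans with (Rpower 2 (- INR 3 * (1 - / p)) * Rpower 2 (- INR 4 * / p)).
- assert (c1 : 1 <= Rpower (Cp p) ((p + 1) / (p - 1))).
  { apply Rle_trans with (Rpower (Cp p) 0); [rewrite Rpower_O; lra|].
    apply Rle_Rpower; auto. apply Rdiv_le_0_compat; lra. }
  rewrite <- Rpower_plus, <- Rmult_1_r. apply Rmult_le_compat.
  + left; apply exp_pos.
  + left; apply exp_pos.
  + apply Rle_Rpower; [lra|]. simpl. lra.
  + rewrite Rpower_Ropp. apply Rle_trans with (/ 1); [|rewrite Rinv_1; lra].
    apply Rinv_le_contravar; lra.
- rewrite <- !Rpower_mult, <- e8, <- e16.
  apply Rmult_le_compat; try (left; apply exp_pos); apply Rle_Rpower_l; try split; lra.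
Qed.
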